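(* Let $(R,m,k)$ be a Noetherian local ring and let $M$ be a finitely generated $R$-module which is generalized Cohen--Macaulay, with $\dim(M)=n$. Then $M$ satisfies Serre's condition $S_r$ for $r=\mathrm{depth}(M)$. Conversely, assume in addition that $M$ is equidimensional and that $R$ is a homomorphic image of a Gorenstein ring. If $M$ satisfies $S_r$ for some $r\leq n$, then $\mathrm{depth}(M)\geq r$.
   Context: Generalized Cohen--Macaulay: a finitely generated module $M$ over a Noetherian local ring $(R,m,k)$ is generalized Cohen--Macaulay if the local cohomology modules $H^i_m(M)$ have finite length for all $0\leq i<\dim M$. Equidimensional: $M$ is equidimensional if all minimal primes $p$ of $\mathrm{Ann}(M)$ have the same dimension $\dim R/p$. Serre's condition: $M$ is $S_r$ if $\mathrm{depth}(M_p)\geq \min\{\dim M_p, r\}$ for every prime $p\in\mathrm{Supp}(M)$, where $\dim M_p$ is the Krull dimension of the $R_p$-module $M_p$. *)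

(* Defs.v *)
From HB Require Import structures.
From mathcomp Require Import all_boot all_order all_algebra ring_quotient.
From mathcomp Require Import ring.
From mathcomp Require Import boolp classical_sets constructive_ereal.

Set Implicit Arguments.
Unset Strict Implicit.
Unset Printing Implicit Defensive.

Import Order.TTheory GRing.Theory Num.Theory.
Local Open Scope ring_scope.
Local Open Scope quotient_scope.

(* Throughout, ideals and submodules are boolean predicates, as in
   ring_quotient (idealr, prime_idealr: proper, resp. prime, ideals) and in
   ssralg (submod_closed, submodClosed).  An ideal of R that may be the unit
   ideal is a submodule of R^o. *)

Definition strict_subset (T : Type) (A B : {pred T}) : Prop :=
  {subset A <= B} /\ ~ {subset B <= A}.

(* Suprema of sets of lengths are taken in the extended integers, so that
   sup set0 = -oo and the supremum of an unbounded set is +oo. *)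
Definition length_sup (A : set nat) : \bar int :=
  supremum -oo%E [set (k%:Z)%:E | k in A]%classic.

Section SubquotientModules.
Variables (R : comNzRingType) (V : lmodType R) (N : submodClosed V).

Definition submodule : Type := {v : V | v \in N}.

HB.instance Definition _ := SubChoice.on submodule.
HB.instance Definition _ := [SubChoice_isSubLmodule of submodule by <:].

(* ssralg does not make a submodClosed predicate a zmodClosed one. *)
Definition submod_pred : {pred V} := fun v => v \in N.

Lemma submod_pred_zmod_closed : zmod_closed submod_pred.
Proof.
split=> [|u v Nu Nv]; first exact: (rpred0 N).
by rewrite -scaleN1r unfold_in /submod_pred (rpredD (S := N)) // (rpredZ (s := N)).
Qed.

HB.instance Definition _ :=
  GRing.isZmodClosed.Build V submod_pred submod_pred_zmod_closed.

Local Notation quotN := (Quotient.quot submod_pred).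

Definition quot_module : Type := quotN.

HB.instance Definition _ := GRing.Zmodule.on quot_module.

Definition quot_scale (a : R) (x : quot_module) : quot_module :=
  \pi_quotN (a *: repr (x : quotN)).

Lemma quot_scale_pi a v : quot_scale a (\pi_quotN v) = \pi_quotN (a *: v).
Proof.
apply/eqP; rewrite -Quotient.idealrBE -scalerBr unfold_in /submod_pred.
rewrite (rpredZ (s := N)) // -[_ \in N]/(_ \in submod_pred).
by rewrite Quotient.idealrBE reprK.
Qed.

Lemma quot_scaleA a b x : quot_scale a (quot_scale b x) = quot_scale (a * b) x.
Proof.
by rewrite -[x](reprK (qT := quotN)) !quot_scale_pi scalerA.
Qed.

Lemma quot_scale1 : left_id 1 quot_scale.
Proof.
by move=> x; rewrite -[x](reprK (qT := quotN)) quot_scale_pi scale1r.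
Qed.

Lemma quot_scaleDr : right_distributive quot_scale +%R.
Proof.
move=> a x y; rewrite -[x](reprK (qT := quotN)) -[y](reprK (qT := quotN)).
rewrite -[X in quot_scale a X]Quotient.pi_add !quot_scale_pi scalerDr.
exact: Quotient.pi_add.
Qed.

Lemma quot_scaleDl x : {morph quot_scale^~ x : a b / a + b}.
Proof.
move=> a b; rewrite -[x](reprK (qT := quotN)) !quot_scale_pi scalerDl.
exact: Quotient.pi_add.
Qed.

HB.instance Definition _ := GRing.Zmodule_isLmodule.Build R quot_module
  quot_scaleA quot_scale1 quot_scaleDr quot_scaleDl.

End SubquotientModules.

Section LocalizationAtPrime.
Variables (R : comNzRingType) (p : prime_idealr R).

Definition denom : Type := {s : R | s \notin p}.

HB.instance Definition _ := SubChoice.on denom.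

Lemma denom1_subproof : 1 \notin p.
Proof. by rewrite idealr1. Qed.

Lemma denomM_subproof (s t : denom) : val s * val t \notin p.
Proof. by rewrite prime_idealrM negb_or (valP s) (valP t). Qed.

Definition denom1 : denom := Sub 1 denom1_subproof.
Definition denomM (s t : denom) : denom :=
  Sub (val s * val t) (denomM_subproof s t).

Definition dval (s : denom) : R := val s.
Arguments dval : simpl never.

Lemma dval1 : dval denom1 = 1. Proof. by []. Qed.

Lemma dvalM s t : dval (denomM s t) = dval s * dval t. Proof. by []. Qed.

Lemma denomMC : commutative denomM.
Proof. by move=> s t; apply: val_inj; rewrite /= mulrC. Qed.

Lemma denomMA : associative denomM.
Proof. by move=> s t u; apply: val_inj; rewrite /= mulrA. Qed.

Lemma denom1M : left_id denom1 denomM.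
Proof. by move=> s; apply: val_inj; rewrite /= mul1r. Qed.

Section Fractions.
Variable V : lmodType R.

Definition frac_equiv (x y : V * denom) : bool :=
  `[< exists u : denom, dval u *: (dval y.2 *: x.1) = dval u *: (dval x.2 *: y.1) >].

Lemma frac_equiv_refl : reflexive frac_equiv.
Proof. by move=> x; apply/asboolP; exists denom1. Qed.

Lemma frac_equiv_sym : symmetric frac_equiv.
Proof. by move=> x y; apply/asboolP/asboolP => -[u e]; exists u. Qed.

Lemma frac_equiv_trans : transitive frac_equiv.
Proof.
move=> [w t] [v s] [z r] /asboolP[/= a e] /asboolP[/= b f].
apply/asboolP; exists (denomM (denomM a b) t); rewrite /= !dvalM.
transitivity ((dval b * dval r) *: (dval a *: (dval t *: v))).
  by rewrite ?dvalM !scalerA; congr (_ *: _); ring.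
rewrite e; transitivity ((dval a * dval s) *: (dval b *: (dval r *: w))).
  by rewrite ?dvalM !scalerA; congr (_ *: _); ring.
by rewrite f !scalerA; congr (_ *: _); ring.
Qed.

Canonical frac_equiv_rel :=
  EquivRel frac_equiv frac_equiv_refl frac_equiv_sym frac_equiv_trans.

(* The localization V_p; its elements are the fractions v / s, s outside p. *)
Definition localization : Type := {eq_quot frac_equiv}.

HB.instance Definition _ : EqQuotient _ frac_equiv localization :=
  EqQuotient.on localization.
HB.instance Definition _ := Choice.on localization.

Definition fracp (v : V) (s : denom) : localization := \pi_localization (v, s).

Lemma fracpP v s w t :
  fracp v s = fracp w t <->
  exists u : denom, dval u *: (dval t *: v) = dval u *: (dval s *: w).
Proof.
rewrite /fracp; split; first by move/eqmodP/asboolP.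
by move=> e; apply/eqmodP/asboolP.
Qed.

Lemma fracp_surj (x : localization) : exists v s, x = fracp v s.
Proof. by elim/quotW: x => -[v s]; exists v, s. Qed.

Lemma fracp_repr (x : localization) : fracp (repr x).1 (repr x).2 = x.
Proof. by rewrite /fracp -surjective_pairing reprK. Qed.

Lemma fracp_scale (u : denom) v s : fracp (dval u *: v) (denomM u s) = fracp v s.
Proof.
by apply/fracpP; exists denom1; rewrite /= ?dvalM !scalerA; congr (_ *: _); ring.
Qed.

Definition loc_add (x y : localization) : localization :=
  let: (v, s) := repr x in let: (w, t) := repr y in
  fracp (dval t *: v + dval s *: w) (denomM s t).

Definition loc_opp (x : localization) : localization :=
  let: (v, s) := repr x in fracp (- v) s.

Lemma loc_addE v s w t :
  loc_add (fracp v s) (fracp w t) =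
  fracp (dval t *: v + dval s *: w) (denomM s t).
Proof.
have := fracp_repr (fracp v s); have := fracp_repr (fracp w t).
rewrite /loc_add; case: (repr _) => [w' t'] /=; case: (repr _) => [v' s'] /=.
move=> /fracpP[b f] /fracpP[a e].
apply/fracpP; exists (denomM a b); rewrite /= ?dvalM !scalerDr !scalerA.
congr (_ + _).
  transitivity ((dval b * dval t * dval t') *: (dval a *: (dval s *: v'))).
    by rewrite ?dvalM !scalerA; congr (_ *: _); ring.
  by rewrite e !scalerA; congr (_ *: _); ring.
transitivity ((dval a * dval s * dval s') *: (dval b *: (dval t *: w'))).
  by rewrite ?dvalM !scalerA; congr (_ *: _); ring.
by rewrite f !scalerA; congr (_ *: _); ring.
Qed.

Lemma loc_oppE v s : loc_opp (fracp v s) = fracp (- v) s.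
Proof.
have := fracp_repr (fracp v s); rewrite /loc_opp.
case: (repr _) => [v' s'] /= /fracpP[a e].
by apply/fracpP; exists a; rewrite !scalerN e.
Qed.

Lemma loc_addC : commutative loc_add.
Proof.
move=> x y; have [v [s ->]] := fracp_surj x; have [w [t ->]] := fracp_surj y.
by rewrite !loc_addE addrC denomMC.
Qed.

Lemma loc_addA : associative loc_add.
Proof.
move=> x y z; have [v [s ->]] := fracp_surj x.
have [w [t ->]] := fracp_surj y; have [q [r ->]] := fracp_surj z.
rewrite !loc_addE denomMA !dvalM !scalerDr !scalerA addrA.
by congr (fracp (_ *: _ + _ *: _ + _ *: _) _); ring.
Qed.

Lemma loc_add0 : left_id (fracp 0 denom1) loc_add.
Proof.
move=> x; have [v [s ->]] := fracp_surj x.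
by rewrite loc_addE scaler0 add0r denom1M dval1 scale1r.
Qed.

Lemma loc_addN : left_inverse (fracp 0 denom1) loc_opp loc_add.
Proof.
move=> x; have [v [s ->]] := fracp_surj x.
rewrite loc_oppE loc_addE scalerN addNr.
by apply/fracpP; exists denom1; rewrite !scaler0.
Qed.

HB.instance Definition _ :=
  GRing.isZmodule.Build localization loc_addA loc_addC loc_add0 loc_addN.

End Fractions.

Section Scaling.
Variable V : lmodType R.

Definition loc_scale (x : localization R^o) (y : localization V) :
    localization V :=
  let: (a, s) := repr x in let: (v, t) := repr y in
  fracp ((a : R) *: v) (denomM s t).

Lemma loc_scaleE (a : R) s (v : V) t :
  loc_scale (fracp (a : R^o) s) (fracp v t) = fracp (a *: v) (denomM s t).
Proof.
have := fracp_repr (fracp (a : R^o) s); have := fracp_repr (fracp v t).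
rewrite /loc_scale; case: (repr _) => [v' t'] /=; case: (repr _) => [a' s'] /=.
move=> /fracpP[c f] /fracpP[b]; rewrite /GRing.scale /= => e.
apply/fracpP; exists (denomM b c); rewrite /= ?dvalM !scalerA.
transitivity ((dval b * (dval s * a')) *: (dval c *: (dval t *: v'))).
  by rewrite ?dvalM !scalerA; congr (_ *: _); ring.
by rewrite e f !scalerA; congr (_ *: _); ring.
Qed.

End Scaling.

Definition loc_mul (x y : localization R^o) : localization R^o := loc_scale x y.

Definition loc_one : localization R^o := fracp (1 : R^o) denom1.

Lemma loc_scaleA (V : lmodType R) x y (z : localization V) :
  loc_scale x (loc_scale y z) = loc_scale (loc_mul x y) z.
Proof.
have [a [s ->]] := fracp_surj x; have [b [t ->]] := fracp_surj y.
have [v [r ->]] := fracp_surj z.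
by rewrite /loc_mul !loc_scaleE denomMA scalerA.
Qed.

Lemma loc_scale1 (V : lmodType R) : left_id loc_one (@loc_scale V).
Proof.
move=> x; have [v [s ->]] := fracp_surj x.
by rewrite loc_scaleE scale1r denom1M.
Qed.

Lemma loc_scaleDr (V : lmodType R) :
  right_distributive (@loc_scale V) +%R.
Proof.
move=> x y z; have [a [s ->]] := fracp_surj x.
have [v [t ->]] := fracp_surj y; have [w [r ->]] := fracp_surj z.
rewrite [_ + _]loc_addE !loc_scaleE [RHS]loc_addE /=.
apply/fracpP; exists denom1; rewrite /= ?dvalM !scalerDr !scalerA.
by congr (_ *: _ + _ *: _); ring.
Qed.

Lemma loc_scaleDl (V : lmodType R) (z : localization V) :
  {morph (@loc_scale V)^~ z : x y / x + y}.
Proof.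
move=> x y; have [a [s ->]] := fracp_surj x; have [b [t ->]] := fracp_surj y.
have [v [r ->]] := fracp_surj z.
rewrite [_ + _]loc_addE !loc_scaleE [RHS]loc_addE /=.
rewrite -[X in fracp (X *: v)]/(dval t * a + dval s * b : R).
apply/fracpP; exists denom1; rewrite !dvalM scalerDl !scalerDr !scalerA.
by congr (_ *: _ + _ *: _); ring.
Qed.

Lemma loc_mulC : commutative loc_mul.
Proof.
move=> x y; have [a [s ->]] := fracp_surj x; have [b [t ->]] := fracp_surj y.
by rewrite /loc_mul !loc_scaleE denomMC /GRing.scale /= mulrC.
Qed.

Lemma loc_mulA : associative loc_mul.
Proof. exact: loc_scaleA. Qed.

Lemma loc_mul1 : left_id loc_one loc_mul.
Proof. exact: loc_scale1. Qed.

Lemma loc_mulDl : left_distributive loc_mul +%R.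
Proof. by move=> x y z; apply: loc_scaleDl. Qed.

Lemma loc_one_neq0 : loc_one != 0.
Proof.
apply/eqP => /fracpP[u]; rewrite /GRing.scale /= !mulr1 !mulr0 => u0.
by have := valP u; rewrite -[val u]/(dval u) u0 idealr0.
Qed.

(* The ring R_p. *)
Definition loc_ring : Type := localization R^o.

HB.instance Definition _ := GRing.Zmodule.on loc_ring.
HB.instance Definition _ := GRing.Zmodule_isComNzRing.Build loc_ring
  loc_mulA loc_mulC loc_mul1 loc_mulDl loc_one_neq0.

HB.instance Definition _ (V : lmodType R) :=
  GRing.Zmodule_isLmodule.Build loc_ring (localization V)
    (@loc_scaleA V) (@loc_scale1 V) (@loc_scaleDr V) (@loc_scaleDl V).

(* The maximal ideal p R_p of R_p. *)
Definition loc_ideal : {pred loc_ring} := fun x =>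
  `[< exists (a : R^o) (s : denom), a \in p /\ x = fracp a s >].

End LocalizationAtPrime.

Section CommutativeAlgebra.
Variable R : comNzRingType.

Definition fin_gen (V : lmodType R) (N : {pred V}) : Prop :=
  exists s : seq V, forall v,
    v \in N <-> exists c : nat -> R, v = \sum_(i < size s) c i *: s`_i.

Definition noetherian : Prop :=
  forall I : {pred R^o}, submod_closed I -> fin_gen I.

Definition maximal_ideal (I : {pred R}) : Prop :=
  idealr_closed I /\
  forall J : {pred R}, idealr_closed J -> {subset I <= J} -> {subset J <= I}.

Definition local_ring (m : {pred R}) : Prop :=
  maximal_ideal m /\ forall I : {pred R}, maximal_ideal I -> I =i m.

Definition prime_chain (I : {pred R}) (l : nat) : Prop :=
  exists c : nat -> prime_idealr R,
    {subset I <= c 0} /\ forall i, (i < l)%N -> strict_subset (c i) (c i.+1).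

(* The Krull dimension of R / I, whose primes are those of R containing I;
   it is -oo when I = R. *)
Definition quot_dim (I : {pred R}) : \bar int :=
  length_sup [set l | prime_chain I l]%classic.

Definition annihilator (M : lmodType R) : {pred R} := fun a =>
  `[< forall v : M, a *: v = 0 >].

Definition krull_dim (M : lmodType R) : \bar int := quot_dim (annihilator M).

Definition minimal_prime (I : {pred R}) (p : prime_idealr R) : Prop :=
  {subset I <= p} /\
  forall q : prime_idealr R,
    {subset I <= q} -> {subset q <= p} -> {subset p <= q}.

Definition equidimensional (M : lmodType R) : Prop :=
  forall p q : prime_idealr R,
    minimal_prime (annihilator M) p -> minimal_prime (annihilator M) q ->
    quot_dim p = quot_dim q.

Definition in_support (M : lmodType R) (p : prime_idealr R) : Prop :=
  exists x : localization p M, x != 0.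

(* The submodule (s_0, ..., s_(k-1)) V. *)
Definition ideal_mul (s : seq R) (V : lmodType R) : {pred V} := fun v =>
  `[< exists c : nat -> V, v = \sum_(i < size s) s`_i *: c i >].

Arguments ideal_mul s V : clear implicits.

Definition regular_seq (M : lmodType R) (s : seq R) : Prop :=
  (forall i, (i < size s)%N -> forall v : M,
     s`_i *: v \in ideal_mul (take i s) M -> v \in ideal_mul (take i s) M) /\
  exists v : M, v \notin ideal_mul s M.

(* For M <> 0: the zero module has no regular sequence, not even the empty
   one, so that it gets depth -oo here. *)
Definition depth (m : {pred R}) (M : lmodType R) : \bar int :=
  length_sup [set l | exists s : seq R,
    [/\ size s = l, {subset s <= m} & regular_seq M s]]%classic.

Definition finite_length (V : lmodType R) : Prop :=
  exists b : nat, forall (l : nat) (c : nat -> {pred V}),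
    (forall i, (i <= l)%N -> submod_closed (c i)) ->
    (forall i, (i < l)%N -> strict_subset (c i) (c i.+1)) ->
    (l <= b)%N.

Definition injective_module (E : lmodType R) : Prop :=
  forall (A B : lmodType R) (f : {linear A -> B}) (g : {linear A -> E}),
    injective f -> exists h : {linear B -> E}, forall a, h (f a) = g a.

Record injective_resolution (M : lmodType R) := InjectiveResolution {
  res_obj :> nat -> lmodType R;
  res_aug : {linear M -> res_obj 0};
  res_diff : forall i, {linear res_obj i -> res_obj i.+1};
  res_injective : forall i, injective_module (res_obj i);
  res_aug_inj : injective res_aug;
  res_exact0 : forall v, res_diff 0 v = 0 <-> exists w, res_aug w = v;
  res_exact : forall i v,
    res_diff i.+1 v = 0 <-> exists w, res_diff i w = v
}.

Definition finite_injective_dimension (M : lmodType R) : Prop :=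
  exists (I : injective_resolution M) (d : nat),
    forall i, (d < i)%N -> forall v : I i, v = 0.

End CommutativeAlgebra.

(* A Noetherian ring all of whose localizations R_p have finite injective
   dimension as modules over themselves. *)
Definition gorenstein (R : comNzRingType) : Prop :=
  noetherian R /\
  forall p : prime_idealr R, finite_injective_dimension (loc_ring p)^o.

Definition image_of_gorenstein (R : comNzRingType) : Prop :=
  exists (S : comNzRingType) (f : {rmorphism S -> R}),
    gorenstein S /\ forall a, exists b, f b = a.

Definition serre (R : comNzRingType) (r : \bar int) (M : lmodType R) : Prop :=
  forall p : prime_idealr R, in_support M p ->
    (Order.min (krull_dim (localization p M)) r
       <= depth (@loc_ideal R p) (localization p M))%E.

Section LocalCohomology.
Variables (R : comNzRingType) (m : {pred R}).

Section TorsionFunctor.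
Variable V : lmodType R.

(* The submodule of the v killed by a power of m; m^t is generated by the
   products of t elements of m. *)
Definition torsion : {pred V} := fun v =>
  `[< exists t : nat, forall a : nat -> R,
        (forall i, a i \in m) -> (\prod_(i < t) a i) *: v = 0 >].

Lemma torsion_submod_closed : submod_closed torsion.
Proof.
split=> [|b u v /asboolP[t ut] /asboolP[s vs]]; apply/asboolP.
  by exists 0 => a _; rewrite scaler0.
exists (t + s)%N => a am; rewrite big_split_ord /=.
set x := \prod_(i < t) _; set y := \prod_(i < s) _.
transitivity ((y * b) *: (x *: u) + x *: (y *: v)).
  by rewrite scalerDr !scalerA; congr (_ *: _ + _); ring.
by rewrite ut // (vs (fun i => a (t + i)%N)) // !scaler0 addr0.
Qed.

HB.instance Definition _ :=
  GRing.isSubmodClosed.Build R V torsion torsion_submod_closed.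

End TorsionFunctor.

Arguments torsion V : clear implicits.

Variables (M : lmodType R) (I : injective_resolution M).

Definition cocycle (i : nat) : {pred I i} := fun v =>
  (v \in torsion (I i)) && (res_diff I i v == 0).

Arguments cocycle i : clear implicits.

Lemma cocycle_submod_closed i : submod_closed (cocycle i).
Proof.
split=> [|b u v /andP[ut /eqP u0] /andP[vt /eqP v0]]; apply/andP; split.
- by rewrite rpred0.
- by rewrite linear0.
- by rewrite rpredD ?rpredZ.
- by rewrite linearP u0 v0 scaler0 addr0.
Qed.

HB.instance Definition _ i :=
  GRing.isSubmodClosed.Build R (I i) (cocycle i) (@cocycle_submod_closed i).

Definition boundary (i : nat) : {pred I i} :=
  match i return {pred I i} with
  | 0 => fun v => v == 0
  | j.+1 => fun v =>
      `[< exists2 w, w \in torsion (I j) & res_diff I j w = v >]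
  end.

Arguments boundary i : clear implicits.

Definition coboundary (i : nat) : {pred submodule (cocycle i)} := fun x =>
  val x \in boundary i.

Arguments coboundary i : clear implicits.

Lemma coboundary_submod_closed i : submod_closed (coboundary i).
Proof.
case: i => [|i]; split=> [|b x y].
- exact: eqxx.
- move=> /eqP x0 /eqP y0; apply/eqP.
  by rewrite linearP /= [val x]x0 [val y]y0 scaler0 addr0.
- by apply/asboolP; exists 0; rewrite ?rpred0 ?linear0.
move=> /asboolP[u ut ux] /asboolP[w wt wy]; apply/asboolP.
exists (b *: u + w); first by rewrite rpredD ?rpredZ.
by rewrite linearP ux wy.
Qed.

HB.instance Definition _ i :=
  GRing.isSubmodClosed.Build R (submodule (cocycle i)) (coboundary i)
    (@coboundary_submod_closed i).

(* H^i_m(M): the i-th cohomology module of the complex obtained by applying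
   the m-torsion functor to the injective resolution I of M. *)
Definition local_cohomology (i : nat) : lmodType R :=
  quot_module (coboundary i).

End LocalCohomology.

(* Up to isomorphism local cohomology does not depend on the injective
   resolution, so that one resolution of M is used in all degrees. *)
Definition generalized_CM (R : comNzRingType) (m : {pred R}) (M : lmodType R) :
    Prop :=
  exists I : injective_resolution M, forall i : nat,
    ((i%:Z)%:E < krull_dim M)%E -> finite_length (local_cohomology m I i).

(* Main.v *)
(* Let m be the maximal ideal. As H^i_m(M) has finite length it is killed by a
   power of m for i < n. Passing to Koszul complexes with coefficients in the
   injective resolution, one obtains a power of m that kills the m-torsion of
   M/tM for every filter regular sequence t of length less than n. This uniform
   bound, applied to the sequences (t, x^k), forces every associated prime
   p <> m of M/tM to have dim R/p >= n - |t|. Extending a filter regular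
   sequence inside a prime p <> m of the support until p is contained in an
   associated prime, one gets depth M_p + dim R/p >= n, so M_p is
   Cohen-Macaulay, while at p = m the condition S_r for r = depth M is trivial.
   The converse is the condition S_r at the prime m itself. *)
From HB Require Import structures.
Require Import Defs.
From mathcomp Require Import all_boot all_order all_algebra ring_quotient.
From mathcomp Require Import ring zify.
From mathcomp Require Import boolp classical_sets constructive_ereal.

Set Implicit Arguments.
Unset Strict Implicit.
Unset Printing Implicit Defensive.

Import Order.TTheory GRing.Theory Num.Theory.
Local Open Scope ring_scope.
Local Open Scope quotient_scope.

(** The Koszul step must show that a class of M/tM which is torsion is represented by a torsion
    cocycle of the complex K, because the hypothesis only controls the cohomology of the torsion
    subcomplex. Filter regularity makes the lower cohomology of K torsion, so K modulo torsion is
    exact in those degrees. Its terms are torsion free and behave like injective modules, so it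
    splits there and its boundaries are saturated. Only finite linear systems have to be solved for
    this, which is why injectivity is used solely in the form of absolute purity.

    The exponent is uniform because adding an element to t is a cone, and a cone at most doubles the
    exponent whatever the element is; hence [2 ^ n * T]. This independence is what allows the bound
    to be applied to a power of x chosen after it: with exponent T, the element x^(T+1) makes x^T u
    divisible by x^(T+1), and Nakayama applies.

    Localization is avoided until the end: statements at a prime are phrased in M itself with
    multipliers outside the prime. *)

Section Submodules.
Variables (R : comNzRingType) (V : lmodType R).
Implicit Types (N L : V -> Prop) (s : seq V).

(** Predicates in [Prop]: colons, torsion and saturations are all given by quantifiers. *)
Definition submod N : Prop :=
  N 0 /\ forall a u v, N u -> N v -> N (a *: u + v).

Lemma submod0 N : submod N -> N 0. Proof. by case. Qed.

Lemma submodD N u v : submod N -> N u -> N v -> N (u + v).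
Proof. by move=> [_ sN] Nu Nv; rewrite -[u]scale1r; apply: sN. Qed.

Lemma submodZ N a u : submod N -> N u -> N (a *: u).
Proof. by move=> [N0 sN] Nu; rewrite -[_ *: _]addr0; apply: sN. Qed.

Lemma submodN N u : submod N -> N u -> N (- u).
Proof. by move=> sN Nu; rewrite -scaleN1r; apply: submodZ. Qed.

Lemma submodB N u v : submod N -> N u -> N v -> N (u - v).
Proof. by move=> sN Nu Nv; apply: submodD => //; apply: submodN. Qed.

Lemma submod_subK N u v : submod N -> N (u - v) -> N v -> N u.
Proof. by move=> sN Nuv Nv; rewrite -[u](subrK v); apply: submodD. Qed.

Lemma submod_sum N (I : finType) (F : I -> V) :
  submod N -> (forall i, N (F i)) -> N (\sum_i F i).
Proof. by move=> sN NF; apply: big_ind => *; [apply: submod0|apply: submodD|]. Qed.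

Lemma submod_zero : submod (fun v => v = 0).
Proof. by split=> // a u v -> ->; rewrite scaler0 addr0. Qed.

Lemma submodI N L : submod N -> submod L -> submod (fun v => N v /\ L v).
Proof.
move=> [N0 sN] [L0 sL]; split=> // a u v [Nu Lu] [Nv Lv].
by split; [apply: sN|apply: sL].
Qed.

Definition sum_submod N L v := exists n l, [/\ N n, L l & v = n + l].

Lemma submod_sum_submod N L : submod N -> submod L -> submod (sum_submod N L).
Proof.
move=> sN sL; split; first by exists 0, 0; split; rewrite ?addr0 //; apply: submod0.
move=> a u v [n [l [Nn Ll ->]]] [n' [l' [Nn' Ll' ->]]].
exists (a *: n + n'), (a *: l + l'); split; [exact: sN.2|exact: sL.2|].
by rewrite scalerDr addrACA.
Qed.

(** Recursive, since the Noetherian and Nakayama arguments peel off one generator at a time; [spanE]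
    gives the sums of [fin_gen]. *)
Fixpoint span s : V -> Prop := fun v =>
  if s is x :: s' then exists a w, span s' w /\ v = a *: x + w else v = 0.

Lemma spanE s v :
  span s v <-> exists c : nat -> R, v = \sum_(i < size s) c i *: s`_i.
Proof.
elim: s v => [|x s IH] v /=.
  split=> [->|[c]]; last by rewrite big_ord0.
  by exists (fun=> 0); rewrite big_ord0.
split=> [[a [w [/IH[c ->] ->]]]|[c ->]].
  exists (fun i => if i is j.+1 then c j else a).
  by rewrite big_ord_recl.
exists (c 0), (\sum_(i < size s) c i.+1 *: s`_i); split.
  by apply/IH; exists (fun i => c i.+1).
by rewrite big_ord_recl.
Qed.

Lemma submod_span s : submod (span s).
Proof.
elim: s => [|x s IH]; first exact: submod_zero.
split=> [|a _ _ [b [u [su ->]]] [c [v [sv ->]]]] /=.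
  by exists 0, 0; split; [apply: submod0|rewrite scale0r addr0].
exists (a * b + c), (a *: u + v); split; first exact: IH.2.
by rewrite scalerDl -scalerA scalerDr addrACA.
Qed.

Lemma span0 s : span s 0. Proof. exact: submod0 (submod_span s). Qed.

Lemma span_mem s x : x \in s -> span s x.
Proof.
elim: s => // y s IH; rewrite inE => /orP[/eqP->|/IH sx] /=.
  by exists 1, 0; split; [apply: span0|rewrite scale1r addr0].
by exists 0, x; rewrite scale0r add0r.
Qed.

Lemma span_min N s v :
  submod N -> (forall x, x \in s -> N x) -> span s v -> N v.
Proof.
move=> sN; elim: s v => [|x s IH] v Ns /=; first by move=> ->; apply: submod0.
move=> [a [w [/IH Nw ->]]]; apply: sN.2; first by apply: Ns; rewrite inE eqxx.
by apply: Nw => y ys; apply: Ns; rewrite inE ys orbT.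
Qed.

Lemma span_catl s t v : span s v -> span (s ++ t) v.
Proof.
apply: span_min; first exact: submod_span.
by move=> x xs; apply: span_mem; rewrite mem_cat xs.
Qed.

Lemma span_catr s t v : span t v -> span (s ++ t) v.
Proof.
apply: span_min; first exact: submod_span.
by move=> x xs; apply: span_mem; rewrite mem_cat xs orbT.
Qed.

Definition fg N : Prop := exists s, forall v, N v <-> span s v.

Definition noeth_mod : Prop := forall N, submod N -> fg N.

Lemma noeth_wf : noeth_mod -> forall Q : (V -> Prop) -> Prop,
  (forall N, submod N ->
     (forall N', submod N' -> (forall v, N v -> N' v) ->
        (exists v, N' v /\ ~ N v) -> Q N') -> Q N) ->
  forall N, submod N -> Q N.
Proof.
move=> noeV Q step N0 sN0; apply: contrapT => nQ0.
pose X := {N | submod N /\ ~ Q N}.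
have [F FP] : exists F : X -> X, forall x : X,
    (forall v, sval x v -> sval (F x) v) /\ exists v, sval (F x) v /\ ~ sval x v.
  have : forall x : X, exists y : X,
    (forall v, sval x v -> sval y v) /\ exists v, sval y v /\ ~ sval x v.
    move=> [N [sN nQ]] /=; apply: contrapT => no; apply: nQ; apply: step => //.
    move=> N' sN' NN' ex; apply: contrapT => nQ'.
    by apply: no; exists (exist _ N' (conj sN' nQ')).
  by move/choice => [F FP]; exists F.
pose C i := sval (iter i F (exist _ N0 (conj sN0 nQ0))).
have sC i : submod (C i) by rewrite /C; case: (iter _ _ _) => [? []].
have Cmono i j v : (i <= j)%N -> C i v -> C j v.
  move=> /subnK <-; elim: (j - i)%N => //= k IH /IH Ckv.
  by rewrite addSn; apply: (FP _).1.
have [s sP] : fg (fun v => exists i, C i v).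
  apply: noeV; split; first by exists 0; apply: submod0.
  move=> a u v [i Ci] [j Cj]; exists (maxn i j); apply: (sC _).2.
    by apply: Cmono Ci; apply: leq_maxl.
  by apply: Cmono Cj; apply: leq_maxr.
have [k Ck] : exists k, forall x, x \in s -> C k x.
  have : forall x, x \in s -> exists i, C i x by move=> x /span_mem/sP.
  elim: s {sP} => [|x s IH] sC'; first by exists 0.
  have [i Ci] := sC' x (mem_head _ _).
  have [|j Cj] := IH; first by move=> y ys; apply: sC'; rewrite inE ys orbT.
  exists (maxn i j) => y; rewrite inE => /orP[/eqP->|/Cj].
    by apply: Cmono Ci; apply: leq_maxl.
  by apply: Cmono; apply: leq_maxr.
have [_ [v [Cv nCv]]] := FP (iter k F (exist _ N0 (conj sN0 nQ0))).
apply: nCv; apply: (span_min (sC k) Ck); apply/sP.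
by exists k.+1.
Qed.

End Submodules.

Notation ideal P := (@submod _ (_^o)%type P).

Section NoetherianModules.
Variable R : comNzRingType.
Hypothesis noeR : noetherian R.

Lemma noeth_ring : noeth_mod R^o.
Proof.
move=> N [N0 sN]; have [|s sP] := noeR (I := fun v => `[< N v >]).
  split=> [|a u v /asboolP Nu /asboolP Nv]; apply/asboolP => //.
  exact: sN.
exists s => v; rewrite spanE -sP; split=> [?|/asboolP//].
exact/asboolP.
Qed.

(** The coefficients of [x] in elements of [N] form an ideal. Lifts to [N] of its finitely many
    generators reduce any element of [N] to one of [N] inside [span s], where induction applies. *)
Lemma fg_sub (V : lmodType R) (s : seq V) (N : V -> Prop) :
  submod N -> (forall v, N v -> span s v) -> fg N.
Proof.
elim: s N => [|x s IH] N sN Ns.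
  by exists [::] => v; split=> [/Ns//|->]; apply: submod0.
pose I (a : R^o) := exists w, span s w /\ N ((a : R) *: x + w).
have sI : submod I.
  split=> [|a b c [w [sw Nw]] [w' [sw' Nw']]].
    exists 0; split; first exact: span0.
    by rewrite scale0r addr0; apply: submod0.
  exists (a *: w + w'); split; first by apply: (submod_span s).2.
  suff -> : ((a *: b + c : R^o) : R) *: x + (a *: w + w') =
     a *: ((b : R) *: x + w) + ((c : R) *: x + w') by apply: sN.2.
  by rewrite scalerDl -scalerA scalerDr addrACA.
have [la laP] := noeth_ring sI.
have [ln [lnN lnP]] : exists ln : seq V, (forall n, n \in ln -> N n) /\
  forall a : R^o, span la a -> exists w, span s w /\ span ln ((a : R) *: x + w).
  have : forall a, a \in la -> I a by move=> a /span_mem/laP.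
  elim: la {laP} => [|b la IHla] Ila.
    exists [::]; split=> // a /= ->; exists 0.
    by split; [apply: span0|rewrite scale0r addr0].
  have [|ln [lnN lnP]] := IHla.
    by move=> a ala; apply: Ila; rewrite inE ala orbT.
  have [w [sw Nw]] := Ila b (mem_head _ _).
  exists (((b : R) *: x + w) :: ln); split=> [n|a /= [c [d [/lnP[w' [sw' nw']] ->]]]].
    by rewrite inE => /orP[/eqP->|/lnN].
  exists (c *: w + w'); split; first by apply: (submod_span s).2.
  exists c, ((d : R) *: x + w'); split=> //.
  by rewrite scalerDl -scalerA scalerDr addrACA.
have [|v [_ Nv]|l' l'P] := IH (fun v => N v /\ span s v) => //.
  by apply: submodI => //; apply: submod_span.
exists (ln ++ l') => v; split=> [Nv|].
  have [a [w [sw vE]]] := Ns v Nv.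
  have [w' [sw' nw']] : exists w', span s w' /\ span ln (a *: x + w').
    by apply: lnP; apply/laP; exists w; rewrite -vE.
  rewrite -[v](subrK (a *: x + w')) addrC; apply: submodD; first exact: submod_span.
    exact: span_catl.
  apply: span_catr; apply/l'P; split.
    by apply: submodB => //; apply: (span_min sN lnN).
  rewrite vE opprD addrACA subrr add0r.
  by apply: submodB => //; apply: submod_span.
apply: span_min => // y; rewrite mem_cat => /orP[/lnN//|/span_mem].
by case/l'P.
Qed.

Lemma noeth_fin_gen (V : lmodType R) : fin_gen (@predT V) -> noeth_mod V.
Proof.
move=> [s sP] N sN; apply: (@fg_sub _ s) => // v _.
by apply/spanE/(iffLR (sP v)).
Qed.

Lemma noeth_ffun (P : finType) : noeth_mod {ffun P -> R^o}.
Proof.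
move=> N sN; apply: (@fg_sub _ [seq [ffun j => (j == i)%:R] | i <- enum P]) => // v _.
have -> : v = \sum_i v i *: [ffun j => (j == i)%:R : R^o].
  apply/ffunP => j; rewrite sum_ffunE (bigD1 j) //= !ffunE eqxx [_ *: _]mulr1.
  by rewrite big1 ?addr0 // => i ij; rewrite !ffunE eq_sym (negPf ij) [_ *: _]mulr0.
apply: submod_sum => [|i]; first exact: submod_span.
apply: submodZ; first exact: submod_span.
by apply: span_mem; apply: map_f; rewrite mem_enum.
Qed.

End NoetherianModules.

Lemma submod_scale (R : comNzRingType) (V : lmodType R) (N : V -> Prop) a :
  submod N -> submod (fun v => N (a *: v)).
Proof.
move=> sN; split; first by rewrite scaler0; apply: submod0.
by move=> b p q Np Nq; rewrite scalerDr scalerA mulrC -scalerA; apply: sN.2.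
Qed.

(** * Torsion with respect to a set of ring elements *)

Section Torsion.
Variables (R : comNzRingType) (m : R -> Prop).

(** The colon N : m^T. Any set of elements is allowed for [m]; for a singleton, [tors] becomes the
    union of the colons by the powers of one element. *)
Fixpoint mkill (T : nat) (V : lmodType R) (N : V -> Prop) (v : V) : Prop :=
  if T is T'.+1 then forall x, m x -> mkill T' N (x *: v) else N v.

Definition tors (V : lmodType R) (N : V -> Prop) (v : V) : Prop :=
  exists T, mkill T N v.

Section OneModule.
Variable V : lmodType R.
Implicit Types N L : V -> Prop.

Lemma mkill_mono T N L : (forall v, N v -> L v) -> forall v, mkill T N v -> mkill T L v.
Proof. by move=> NL; elim: T => //= T IH v kv x /kv /IH. Qed.

Lemma submod_mkill T N : submod N -> submod (mkill T N).
Proof.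
move=> sN; elim: T => //= T IH; split=> [x _|a u v ku kv x mx].
  by rewrite scaler0; apply: submod0.
rewrite scalerDr scalerA mulrC -scalerA; apply: IH.2; first exact: ku.
exact: kv.
Qed.

Lemma mkillD S T N v : mkill (S + T) N v = mkill S (mkill T N) v.
Proof. by elim: S v => //= S IH v; apply: eq_forall => x; rewrite IH. Qed.

Lemma mkill_le S T N v : submod N -> (S <= T)%N -> mkill S N v -> mkill T N v.
Proof.
move=> sN /subnK <-; rewrite addnC mkillD; apply: mkill_mono => {}v Nv.
elim: (T - S)%N v Nv => //= k IH v Nv x _; apply: IH; exact: submodZ.
Qed.

Lemma mkill_exp T N x v : m x -> mkill T N v -> N (x ^+ T *: v).
Proof.
move=> mx; elim: T v => [|T IH] v /=; first by rewrite expr0 scale1r.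
by move=> /(_ x mx)/IH; rewrite scalerA exprSr.
Qed.

(** Comparison with the products in [torsion]; [m 0] supplies a sequence in [m] for the empty
    product. *)
Lemma mkill_prod T N v : m 0 ->
  mkill T N v <-> forall a : nat -> R, (forall i, m (a i)) -> N ((\prod_(i < T) a i) *: v).
Proof.
move=> m0; elim: T v => [|T IH] v /=.
  split=> [Nv a _|/(_ (fun=> 0) (fun=> m0))]; last by rewrite big_ord0 scale1r.
  by rewrite big_ord0 scale1r.
split=> [kv a ma|Nv x mx].
  rewrite big_ord_recl mulrC -scalerA.
  exact: (iffLR (IH _) (kv _ (ma 0%N)) (fun i => a i.+1)).
apply/IH => a ma; pose b i := if i is j.+1 then a j else x.
have := Nv b; rewrite big_ord_recl mulrC -scalerA /=; apply.
by case.
Qed.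

Lemma submod_tors N : submod N -> submod (tors N).
Proof.
move=> sN; split; first by exists 0; apply: submod0.
move=> a u v [S ku] [T kv]; exists (maxn S T); apply: (submod_mkill _ sN).2.
  exact: mkill_le (leq_maxl _ _) ku.
exact: mkill_le (leq_maxr _ _) kv.
Qed.

Lemma tors_sub N v : N v -> tors N v. Proof. by exists 0. Qed.

Lemma tors_mono N L v : (forall v, N v -> L v) -> tors N v -> tors L v.
Proof. by move=> NL [T kv]; exists T; apply: mkill_mono kv. Qed.

End OneModule.

(** Transports killing along linear maps, and also along maps such as c |-> c v, for which only
    scaling has to be checked. *)
Lemma mkill_preim (V W : lmodType R) (f : V -> W) (N : W -> Prop) T v :
  (forall a u, f (a *: u) = a *: f u) ->
  mkill T (fun u => N (f u)) v = mkill T N (f v).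
Proof.
move=> fZ; elim: T v => //= T IH v.
by apply: eq_forall => x; rewrite IH fZ.
Qed.

End Torsion.

Definition prime_id (R : comNzRingType) (P : R -> Prop) : Prop :=
  [/\ ideal P, ~ P 1 & forall a b, P (a * b) -> P a \/ P b].

Section Ideals.
Variables (R : comNzRingType) (P : R -> Prop).
Hypothesis iP : ideal P.

Lemma ideal0 : P 0. Proof. exact: submod0 iP. Qed.

Lemma idealM a b : P b -> P (a * b). Proof. exact: (submodZ a iP). Qed.

Lemma idealD a b : P a -> P b -> P (a + b). Proof. exact: submodD iP. Qed.

Lemma idealB a b : P a -> P b -> P (a - b). Proof. exact: submodB iP. Qed.

Lemma ideal_subK a b : P (a - b) -> P b -> P a. Proof. exact: submod_subK iP. Qed.

End Ideals.

Lemma prime_exp (R : comNzRingType) (P : R -> Prop) x t :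
  prime_id P -> P (x ^+ t) -> P x.
Proof.
by move=> [_ P1 Pp]; elim: t => [|t IH]; rewrite ?expr0 ?exprS // => /Pp[].
Qed.

(** * Nakayama's lemma at a prime, without localizing *)

Section Nakayama.
Variables (R : comNzRingType) (P : R -> Prop) (V : lmodType R).
Hypothesis pP : prime_id P.

(** The submodule P (s), with one coefficient in [P] per generator so that a single one can be
    isolated. *)
Fixpoint pspan (s : seq V) (v : V) : Prop :=
  if s is x :: s' then exists a w, [/\ P a, pspan s' w & v = a *: x + w] else v = 0.

Lemma submod_pspan s : submod (pspan s).
Proof.
have [iP _ _] := pP.
elim: s => [|x s IH]; first exact: submod_zero.
split=> [|a _ _ [b [u [Pb su ->]]] [c [v [Pc sv ->]]]] /=.
  by exists 0, 0; split; [apply: ideal0 iP|apply: submod0|rewrite scale0r addr0].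
exists (a * b + c), (a *: u + v); split; first by apply: idealD => //; apply: idealM.
  exact: IH.2.
by rewrite scalerDl -scalerA scalerDr addrACA.
Qed.

Lemma pspanZ s x v : P x -> span s v -> pspan s (x *: v).
Proof.
move=> Px; elim: s v => [|y s IH] v /=; first by move=> ->; rewrite scaler0.
move=> [a [w [/IH sw ->]]]; exists (a * x), (x *: w); split=> //.
  by apply: idealM; have [] := pP.
by rewrite scalerDr scalerA mulrC.
Qed.

(** Gaussian elimination: the coefficient [a] of [x] on the right lies in [P], so [u - a] is still
    outside [P] and the equation can be solved for [x] up to this multiplier. *)
Lemma nakayama (N : V -> Prop) s : submod N ->
  (forall x, x \in s -> exists u n y, [/\ ~ P u, N n, pspan s y & u *: x = n + y]) ->
  exists u, ~ P u /\ forall x, x \in s -> N (u *: x).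
Proof.
have [iP P1 Pp] := pP.
move=> sN; elim: s => [|x s IH] sP; first by exists 1.
have [u [n [y [Pu Nn /= [a [w [Pa sw ->]]] e]]]] := sP x (mem_head _ _).
have Pua : ~ P (u - a) by move=> /(ideal_subK iP)/(_ Pa).
have ex : (u - a) *: x = n + w.
  by rewrite scalerBl e addrCA addrAC subrr add0r.
have [z zs|u' [Pu' u'P]] := IH.
  have [|h [k [_ [Ph Nk [b [q [Pb sq ->]]] ez]]]] := sP z.
    by rewrite inE zs orbT.
  (* The equation for [z] times [u - a], with [x] eliminated by [ex]. *)
  exists ((u - a) * h), ((u - a) *: k + b *: n), (b *: w + (u - a) *: q); split.
  - by case/Pp.
  - by apply: submodD => //; apply: submodZ.
  - have sp := submod_pspan s.
    by apply: submodD => //; apply: submodZ.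
  - rewrite -scalerA ez !scalerDr [_ *: (b *: x)]scalerA mulrC -scalerA ex.
    by rewrite scalerDr -!addrA.
exists (u' * (u - a)); split; first by case/Pp.
move=> z; rewrite inE => /orP[/eqP->|zs]; last first.
  by rewrite mulrC -scalerA; apply: submodZ=> //; apply: u'P.
rewrite -scalerA ex scalerDr; apply: submodD => //; first exact: submodZ.
have : span s w by elim: s w {sP IH ex u'P e} sw => //= ? ? IH w [b [q [_ /IH ? ->]]]; exists b, q.
exact: (span_min (submod_scale u' sN)).
Qed.

Lemma nakayama_mul (N U : V -> Prop) x : submod N -> fg U -> P x ->
  (forall u, U u -> exists h n w, [/\ ~ P h, N n, U w & h *: u = n + x *: w]) ->
  exists h, ~ P h /\ forall u, U u -> N (h *: u).
Proof.
move=> sN [s sP] Px UP; have [y ys|h [Ph hP]] := @nakayama N s sN.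
  have [|h [n [w [Ph Nn /sP Uw e]]]] := UP y; first exact/sP/span_mem.
  by exists h, n, (x *: w); split=> //; apply: pspanZ.
exists h; split=> // u /sP; exact: (span_min (submod_scale h sN)).
Qed.

End Nakayama.

(** * Prime ideals *)

Section Avoidance.
Variable R : comNzRingType.
Implicit Types (P J : R -> Prop).

(* [prime_like] also allows the empty predicate and all of [R]. *)
Definition prime_like P : Prop :=
  [/\ forall a b, P a -> P b -> P (a - b), forall a b, P b -> P (a * b)
    & forall a b, P (a * b) -> P a \/ P b].

Lemma prime_avoidance J k (P : nat -> R -> Prop) : ideal J ->
  (forall i, (i < k)%N -> prime_like (P i) /\ exists x, J x /\ ~ P i x) ->
  exists x, J x /\ forall i, (i < k)%N -> ~ P i x.
Proof.
move=> iJ; elim: k P => [|k IH] P PP; first by exists 0; split=> //; apply: ideal0.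
have [x [Jx xP]] : exists x, J x /\ forall i, (i < k)%N -> ~ P i x.
  by apply: IH => i ik; apply: PP; apply: ltnW.
have [Pkx|nPkx] := pselect (P k x); last first.
  exists x; split=> // i; rewrite ltnS leq_eqVlt => /orP[/eqP->//|].
  exact: xP.
have [[PkB PkM Pkp] [j [Jj Pkj]]] := PP k (ltnSn k).
have [[i [ik PiPk]]|nsub] :=
    pselect (exists i, (i < k)%N /\ forall y, P i y -> P k y).
  (* [P i] is contained in [P k], so [P k] can take its place in the family. *)
  have [|y [Jy yP]] := IH (fun l => if l == i then P k else P l).
    by move=> l lk; case: ifP => _; apply: PP => //; apply: ltnW.
  exists y; split=> // l; rewrite ltnS leq_eqVlt => /orP[/eqP->|lk].
    by have := yP i ik; rewrite eqxx.
  by have := yP l lk; case: eqP => // -> Pky /PiPk.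
(* Adding such a [z] to [x] moves it out of [P k] without changing its class modulo the other
   [P i]. *)
have [z [Jz Pkz zP]] : exists z, [/\ J z, ~ P k z & forall i, (i < k)%N -> P i z].
  have : forall i, (i < k)%N -> exists y, P i y /\ ~ P k y.
    move=> i ik; apply: contrapT => no; apply: nsub; exists i; split=> // y Piy.
    by apply: contrapT => nPky; apply: no; exists y.
  move=> ex; suff: forall l, (l <= k)%N ->
    exists z, [/\ J z, ~ P k z & forall i, (i < l)%N -> P i z] by apply.
  elim=> [|l IHl] lk; first by exists j.
  have [z [Jz Pkz zP]] := IHl (ltnW lk).
  have [y [Ply Pky]] := ex l lk.
  exists (y * z); split; [exact: idealM|by case/Pkp|].
  move=> i; rewrite ltnS leq_eqVlt => /orP[/eqP->|il].
    have [[_ PM _] _] := PP l (ltnW lk).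
    by rewrite mulrC; apply: PM.
  have [[_ PM _] _] := PP i (ltnW (ltn_trans il lk)).
  by apply: PM; apply: zP.
exists (x + z); split; first exact: idealD.
move=> i; rewrite ltnS leq_eqVlt => /orP[/eqP->|ik].
  by move=> /PkB/(_ Pkx); rewrite addrC addKr.
have [[PB _ _] _] := PP i (ltnW ik).
by move=> /PB/(_ (zP i ik)); rewrite addrK; apply: xP.
Qed.

End Avoidance.

Section AssociatedPrimes.
Variables (R : comNzRingType).
Hypothesis noeR : noetherian R.

(** The associated primes of V/N. *)
Definition assoc (V : lmodType R) (N : V -> Prop) (P : R -> Prop) : Prop :=
  prime_id P /\ exists v, forall a, P a <-> N (a *: v).

Lemma ideal_colon (V : lmodType R) (N : V -> Prop) v :
  submod N -> ideal (fun a => N (a *: v)).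
Proof.
move=> sN; split; first by rewrite scale0r; apply: submod0.
by move=> a b c Nb Nc; rewrite scalerDl -scalerA; apply: sN.2.
Qed.

(** A maximal annihilator among those of the nonzero multiples of [u] in V/N is prime. *)
Lemma prime_colon (V : lmodType R) (N : V -> Prop) u : submod N -> ~ N u ->
  exists a, prime_id (fun c => N (c *: (a *: u))).
Proof.
move=> sN Nu.
suff : forall I : R^o -> Prop, submod I -> forall a, ~ N (a *: u) ->
    (forall c : R, I c <-> N (c *: (a *: u))) -> exists a, prime_id (fun c => N (c *: (a *: u))).
  by move=> /(_ _ (ideal_colon (1 *: u) sN) 1); apply; rewrite ?scale1r.
apply: (noeth_wf (noeth_ring noeR)) => I sI IH a Nau IP.
have [[b [c [Nbc Nb Nc]]]|npr] := pselect (exists b c,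
   [/\ N ((b * c) *: (a *: u)), ~ N (b *: (a *: u)) & ~ N (c *: (a *: u))]).
  have [| | |//|d dP] := IH _ (ideal_colon ((b * a) *: u) sN) _ _ (b * a).
  - move=> d Id; have Nd := iffLR (IP d) Id.
    by move: (submodZ b sN Nd); rewrite !scalerA mulrCA mulrA.
  - exists c; split; last by move=> Ic; apply/Nc/IP.
    by move: Nbc; rewrite !scalerA mulrCA mulrA.
  - by rewrite -scalerA.
  by exists d.
exists a; split; [exact: ideal_colon|by rewrite scale1r|].
move=> b c Nbc; apply: contrapT => /not_orP[Nb Nc]; apply: npr.
by exists b, c.
Qed.

(** Noetherian induction on [N]: with [w] of prime annihilator modulo [N], an associated prime of
    V/N is that annihilator or is associated to V/(N + Rw). *)
Lemma assoc_finite (V : lmodType R) (N : V -> Prop) : noeth_mod V -> submod N ->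
  exists k (P : nat -> R -> Prop), forall Q, assoc N Q ->
    exists i, (i < k)%N /\ forall a, Q a <-> P i a.
Proof.
move=> noeV; move: N; apply: noeth_wf => // N sN IH.
have [[u Nu]|noN] := pselect (exists u, ~ N u); last first.
  exists 0, (fun _ _ => False) => Q [[_ Q1 _] [v Qv]].
  by case: Q1; apply/Qv; apply: contrapT => ?; apply: noN; exists (1 *: v).
have [a pP] := prime_colon sN Nu; move: (a *: u) pP => w pP.
have [_ P1 Pp] := pP; rewrite scale1r in P1.
pose N' := sum_submod N (fun v => exists c, v = c *: w).
have NN' v : N v -> N' v.
  by move=> Nv; exists v, 0; split; rewrite ?addr0 //; exists 0; rewrite scale0r.
have N'w : N' w.
  by exists 0, w; split; [apply: submod0| exists 1; rewrite scale1r|rewrite add0r].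
have sN' : submod N'.
  apply: submod_sum_submod => //; split; first by exists 0; rewrite scale0r.
  move=> b _ _ [c ->] [d ->]; exists (b * c + d).
  by rewrite scalerDl scalerA.
have [||k [P PP]] := IH N' sN'; [by []|by exists w|].
exists k.+1, (fun i => if i == k then (fun c => N (c *: w)) else P i).
move=> Q [pQ [v Qv]]; have [iQ Q1 Qp] := pQ.
(* If so, [b *: v] is a multiple of [w] modulo [N], nonzero there, and primality makes both
   annihilators agree. If not, [v] has the same colon modulo [N] and [N']. *)
have [[b [N'b Nb]]|no] := pselect (exists b, N' (b *: v) /\ ~ N (b *: v)).
  exists k; split=> //; rewrite eqxx => c.
  have [n [_ [Nn [d ->] e]]] := N'b.
  have Nd : ~ N (d *: w).
    by move=> Nd; apply: Nb; rewrite e; apply: submodD.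
  have Qc : Q c <-> N (c *: (b *: v)).
    rewrite scalerA -Qv; split=> [Qc|/Qp[//|/Qv//]].
    by rewrite mulrC; apply: idealM.
  have Pc : N (c *: w) <-> N (c *: (d *: w)).
    rewrite scalerA; split=> [Nc|Ncd]; last by case: (Pp _ _ Ncd).
    by rewrite mulrC -scalerA; apply: submodZ.
  rewrite Qc Pc e scalerDr; split=> H.
    by have := submodB sN H (submodZ c sN Nn); rewrite addrC addKr.
  by apply: submodD => //; apply: submodZ.
have [|i [ik iP]] := PP Q.
  split=> //; exists v => c; rewrite Qv; split=> [/NN'//|N'c].
  by apply: contrapT => Nc; apply: no; exists c.
by exists i; split; [apply: ltnW|rewrite ltn_eqF].
Qed.

(* The colon of [w] modulo [N] and modulo a larger submodule [L] differ only by
   elements that a multiplier [b] outside [P] absorbs. *)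
Lemma assoc_transfer (V : lmodType R) (N L : V -> Prop) (P : R -> Prop) w b :
  prime_id P -> (forall v, N v -> L v) -> (forall c, L (c *: w) -> P c) ->
  ~ P b -> (forall c, P c -> N (b *: (c *: w))) -> assoc N P.
Proof.
move=> pP NL LP Pb bP; have [_ _ Pp] := pP; split=> //; exists (b *: w) => c; split.
  by move=> /bP; rewrite !scalerA mulrC.
by rewrite scalerA => /NL/LP/Pp[].
Qed.

End AssociatedPrimes.

(** * Criteria for torsion, and elements regular up to torsion *)

Section MaximalIdealTorsion.
Variables (R : comNzRingType) (m : R -> Prop).
Hypothesis noeR : noetherian R.

(** The conclusion says that J^T lies in [I]. If [I] is neither prime nor the unit ideal, some
    product ab lies in [I] with neither factor in it, and powers of [J] inside I + (a) and I + (b)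
    multiply into [I]. *)
Lemma radical_power (J I : R -> Prop) : ideal I ->
  (forall P, prime_id P -> (forall a, I a -> P a) -> forall a, J a -> P a) ->
  exists T, @mkill R J T R^o I 1.
Proof.
move: I; apply: (noeth_wf (noeth_ring noeR)) => I sI IH IP.
have iI : ideal I by [].
have [I1|nI1] := pselect (I 1); first by exists 0.
have [[a [b [Iab Ia Ib]]]|npr] := pselect (exists a b : R, [/\ I (a * b), ~ I a & ~ I b]).
  pose add c : R^o -> Prop := sum_submod I (fun d => exists r : R, d = r * c).
  have sadd c : submod (add c).
    apply: submod_sum_submod => //; split; first by exists 0; rewrite mul0r.
    by move=> d _ _ [r ->] [r' ->]; exists (d * r + r'); rewrite mulrDl -mulrA.
  have Iadd c d : I d -> add c d.
    by move=> Id; exists d, 0; split; rewrite ?addr0 //; exists 0; rewrite mul0r.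
  have addc c : add c c.
    exists 0, c; split; rewrite ?add0r //; first exact: submod0 sI.
    by exists 1; rewrite mul1r.
  have ex c : ~ I c -> exists T, @mkill R J T R^o (add c) 1.
    move=> Ic; apply: (IH _ (sadd c) (Iadd c)); first by exists c.
    by move=> P pP addP; apply: IP => // d Id; apply: addP; apply: Iadd.
  have [S kS] := ex a Ia; have [T kT] := ex b Ib.
  exists (S + T)%N; rewrite mkillD; apply: mkill_mono kS => c [i [_ [Ii [r ->] ->]]].
  have : @mkill R J T R^o (fun y : R^o => I ((y : R) * (i + r * a))) 1.
    apply: mkill_mono kT => d [j [_ [Ij [s ->] ->]]].
    have -> : (j + s * b) * (i + r * a) = (i + r * a) * j + (s * b) * i + (s * r) * (a * b).
      by ring.
    by apply: (idealD iI); [apply: (idealD iI)|]; apply: idealM.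
  rewrite (@mkill_preim R J R^o R^o (fun y : R^o => (y : R) * (i + r * a)) I).
    by rewrite mul1r.
  by move=> d u; rewrite -[RHS]/(d * (u * _)) mulrA.
exists 1%N => x Jx; rewrite -[_ *: _]/(x * 1) mulr1; apply: (IP I) => //.
split=> // a b Iab; apply: contrapT => /not_orP[Ia Ib].
by apply: npr; exists a, b.
Qed.

Section OneModule.
Variables (V : lmodType R).
Implicit Types N U : V -> Prop.

Lemma tors_radical N v : submod N ->
  (forall P, prime_id P -> (forall a, N (a *: v) -> P a) -> forall a, m a -> P a) ->
  tors m N v.
Proof.
move=> sN /(radical_power (ideal_colon v sN))[T].
rewrite (@mkill_preim R m R^o V (fun a : R^o => (a : R) *: v) N) ?scale1r.
  by exists T.
by move=> a u; rewrite scalerA.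
Qed.

Lemma tors_exp N v : submod N -> (forall x, m x -> exists t, N (x ^+ t *: v)) ->
  tors m N v.
Proof.
move=> sN Nx; apply: tors_radical => // P pP NP x mx.
by have [t /NP/prime_exp] := Nx x mx; apply.
Qed.

Lemma tors_gen N v (g : seq R^o) : submod N -> (forall x, m x -> span g x) ->
  (forall x : R, x \in g -> exists t, N (x ^+ t *: v)) -> tors m N v.
Proof.
move=> sN mg Nx; apply: tors_radical => // P pP NP x /mg.
have [iP _ _] := pP.
apply: (span_min iP) => y /Nx[t /NP]; exact: prime_exp.
Qed.

Lemma tors_colon N v : submod N -> (forall x, m x -> tors m N (x *: v)) -> tors m N v.
Proof.
move=> sN Nx; apply: tors_exp => // x mx; have [T /(mkill_exp mx)] := Nx x mx.
by rewrite scalerA -exprSr; exists T.+1.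
Qed.

Lemma tors_idem N v : submod N -> tors m (tors m N) v -> tors m N v.
Proof.
move=> sN [T]; elim: T v => //= T IH v kv.
by apply: tors_colon => // x /kv/IH.
Qed.

Lemma tors_cancel N x v : submod N -> (forall u, N (x *: u) -> tors m N u) ->
  tors m N (x *: v) -> tors m N v.
Proof.
move=> sN xreg [T]; have xZ a (u : V) : x *: (a *: u) = a *: (x *: u).
  by rewrite !scalerA mulrC.
rewrite -(mkill_preim m N T v xZ) => kv.
by apply: tors_idem => //; exists T; apply: mkill_mono kv.
Qed.

Lemma tors_uniform N U : submod N -> fg U -> (forall u, U u -> tors m N u) ->
  exists T, forall u, U u -> mkill m T N u.
Proof.
move=> sN [s sP] Ut; have : forall x, x \in s -> tors m N x.
  by move=> x /span_mem/sP/Ut.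
move=> st; suff [T TP] : exists T, forall x, x \in s -> mkill m T N x.
  exists T => u /sP; apply: span_min TP; exact: submod_mkill.
elim: s st {sP} => [|x s IH] st; first by exists 0.
have [S kx] := st x (mem_head _ _); have [|T kT] := IH.
  by move=> y ys; apply: st; rewrite inE ys orbT.
exists (maxn S T) => y; rewrite inE => /orP[/eqP->|/kT].
  exact: mkill_le (leq_maxl _ _) kx.
by apply: (mkill_le sN); apply: leq_maxr.
Qed.

End OneModule.

Section Nonzerodivisors.
Variable V : lmodType R.
Implicit Type N : V -> Prop.

(** Otherwise a multiple [w] of [v] has a prime colon modulo the torsion, containing [x] but not
    [m]. A power of an element of [m] outside that prime absorbs the torsion, so the prime is
    associated to V/N itself. *)
Lemma nonzerodivisor_up_to_tors N x v : submod N ->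
  (forall Q, assoc N Q -> ~ (forall y, m y -> Q y) -> ~ Q x) ->
  N (x *: v) -> tors m N v.
Proof.
move=> sN Qx Nxv; apply: contrapT => nt; have sT := submod_tors m sN.
have [a pP] := prime_colon noeR sT nt; set w := a *: v in pP.
have [iP P1 Pp] := pP.
have nmP : ~ forall y, m y -> tors m N (y *: w).
  by move=> /(tors_colon sN) tw; apply: P1; rewrite scale1r.
(* One exponent for the whole prime, which is finitely generated. *)
have [T TP] : exists T, forall c : R, tors m N (c *: w) -> mkill m T N (c *: w).
  have wZ (a' u : R^o) : (a' *: u : R) *: w = a' *: ((u : R) *: w) by exact: esym (scalerA _ _ _).
  have tP (c : R^o) : tors m N ((c : R) *: w) -> tors m (fun a : R^o => N ((a : R) *: w)) c.
    by move=> [S kS]; exists S; rewrite (mkill_preim m N S c wZ).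
  have [T TP] := tors_uniform (ideal_colon w sN) (noeth_ring noeR iP) tP.
  by exists T => c tc; rewrite -(mkill_preim m N T (c : R^o) wZ); apply: TP.
have [y [my nPy]] : exists y, m y /\ ~ tors m N (y *: w).
  apply: contrapT => no; apply: nmP => y my.
  by apply: contrapT => ny; apply: no; exists y.
apply: (Qx (fun c => tors m N (c *: w))).
- apply: (@assoc_transfer _ _ N (tors m N) _ w (y ^+ T)) => //.
  + by move=> ?; apply: tors_sub.
  + by move/(prime_exp pP).
  + by move=> c /TP/(mkill_exp my).
- by move/(_ y my).
- by apply: tors_sub; rewrite scalerA mulrC -scalerA; apply: submodZ.
Qed.

Lemma exists_nonzerodivisor N (J : R -> Prop) : noeth_mod V -> submod N -> ideal J ->
  (forall Q, assoc N Q -> ~ (forall y, m y -> Q y) -> exists z, J z /\ ~ Q z) ->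
  exists x, J x /\ forall Q, assoc N Q -> ~ (forall y, m y -> Q y) -> ~ Q x.
Proof.
move=> noeV sN iJ JQ; have [k [P PP]] := assoc_finite noeR noeV sN.
pose good i := assoc N (P i) /\ ~ (forall y, m y -> P i y).
(* Indices that do not give a relevant associated prime are padded with the empty predicate. *)
have [|x [Jx xP]] := @prime_avoidance R J k
    (fun i => if `[< good i >] then P i else fun=> False) iJ.
  move=> i ik; case: asboolP => [[aP mP]|_]; last first.
    by split=> //; exists 0; split=> //; apply: ideal0.
  split; last exact: JQ.
  have [[iP _ Pp] _] := aP.
  by split; [exact: (@idealB _ _ iP)|exact: (@idealM _ _ iP)|].
exists x; split=> // Q aQ mQ Qx; have [i [ik Qi]] := PP Q aQ.
have eQ : Q = P i by apply/funext => a; apply/propext.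
by apply: (xP i ik); case: asboolP => // -[]; rewrite /good -?eQ.
Qed.

End Nonzerodivisors.

End MaximalIdealTorsion.

(** * Saturation at a prime, and chains of primes *)

Section Saturation.
Variables (R : comNzRingType) (V : lmodType R).

(** The preimage of N_P under V -> V_P. *)
Definition sat (P : R -> Prop) (N : V -> Prop) (v : V) : Prop :=
  exists h, ~ P h /\ N (h *: v).

Section OnePrime.
Variables (P : R -> Prop) (N : V -> Prop).
Hypotheses (pP : prime_id P) (sN : submod N).

Lemma sat_sub v : N v -> sat P N v.
Proof. by move=> Nv; exists 1; rewrite scale1r; have [] := pP. Qed.

Lemma submod_sat : submod (sat P N).
Proof.
have [_ P1 Pp] := pP; split; first by apply: sat_sub; apply: submod0.
move=> a u v [h [Ph Nu]] [k [Pk Nv]]; exists (h * k); split; first by case/Pp.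
rewrite scalerDr; apply: submodD => //.
  rewrite scalerA [h * k * a](_ : _ = k * a * h); last by ring.
  by rewrite -scalerA; apply: submodZ.
by rewrite -scalerA; apply: submodZ.
Qed.

Lemma sat_idem h v : ~ P h -> sat P N (h *: v) -> sat P N v.
Proof.
have [_ _ Pp] := pP.
by move=> Ph [k [Pk Nv]]; exists (k * h); rewrite -scalerA; split=> // /Pp[].
Qed.

Lemma sat_uniform U : fg U -> (forall u, U u -> sat P N u) ->
  exists h, ~ P h /\ forall u, U u -> N (h *: u).
Proof.
have [_ P1 Pp] := pP.
move=> [s sP] Us; have {}Us x : x \in s -> sat P N x by move=> /span_mem/sP/Us.
suff [h [Ph hP]] : exists h, ~ P h /\ forall x, x \in s -> N (h *: x).
  exists h; split=> // u /sP; apply: (span_min (N := fun v => N (h *: v))) => //.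
  exact: submod_scale.
elim: s Us {sP} => [|x s IH] Us; first by exists 1.
have [h [Ph Nx]] := Us x (mem_head _ _); have [y ys|k [Pk kP]] := IH.
  by apply: Us; rewrite inE ys orbT.
exists (h * k); split=> [/Pp[]//|y]; rewrite inE => /orP[/eqP->|/kP Ny].
  by rewrite mulrC -scalerA; apply: submodZ.
by rewrite -scalerA; apply: submodZ.
Qed.

Lemma tors_sat (m : R -> Prop) v :
  ~ (forall x, m x -> P x) -> tors m N v -> sat P N v.
Proof.
move=> mP [T kv]; have [x [mx Px]] : exists x, m x /\ ~ P x.
  apply: contrapT => no; apply: mP => x mx.
  by apply: contrapT => Px; apply: no; exists x.
exists (x ^+ T); split; first by move/(prime_exp pP).
exact: mkill_exp kv.
Qed.

End OnePrime.

End Saturation.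

Section PrimeChains.
Variable R : comNzRingType.
Implicit Types P Q : R -> Prop.

(** A strict chain of primes of length [k] going up from [P], so a witness of dim R/P >= k. *)
Fixpoint chain (k : nat) P : Prop :=
  prime_id P /\ if k is k'.+1 then
    exists Q, [/\ forall a, P a -> Q a, exists a, Q a /\ ~ P a & chain k' Q]
  else True.

Lemma chain_sub k P Q : prime_id P -> (forall a, P a -> Q a) -> chain k Q -> chain k P.
Proof.
move=> pP PQ; case: k => [|k] [_ c]; split=> //.
move: c => [L [QL [a [La Qa]] cL]]; exists L; split=> // [b /PQ/QL//|].
by exists a; split=> // /PQ.
Qed.

End PrimeChains.

(** * Filter regular sequences *)

Section FilterRegularSequences.
Variables (R : comNzRingType) (m : R -> Prop).
Hypothesis noeR : noetherian R.
Hypothesis pm : prime_id m.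
Hypothesis local : forall I : R -> Prop, ideal I -> ~ I 1 -> forall a, I a -> m a.

Section OneModule.
Variable V : lmodType R.
Hypothesis noeV : noeth_mod V.

(* Sequences are listed backwards: [x :: t] is [t] followed by [x]. *)
Fixpoint ideal_smul (t : seq R) (v : V) : Prop :=
  if t is x :: t' then exists n w, ideal_smul t' n /\ v = n + x *: w else v = 0.

Fixpoint filter_regular (t : seq R) : Prop :=
  if t is x :: t' then filter_regular t' /\
    forall v, ideal_smul t' (x *: v) -> tors m (ideal_smul t') v
  else True.

Lemma submod_ideal_smul t : submod (ideal_smul t).
Proof.
elim: t => [|x t IH]; first exact: submod_zero.
split; first by exists 0, 0; rewrite scaler0 addr0; split=> //; apply: submod0.
move=> a _ _ [n [w [Nn ->]]] [n' [w' [Nn' ->]]].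
exists (a *: n + n'), (a *: w + w'); split; first exact: IH.2.
by rewrite !scalerDr !scalerA [x * a]mulrC addrACA.
Qed.

Lemma ideal_smul_cons x t v : ideal_smul t v -> ideal_smul (x :: t) v.
Proof. by move=> tv; exists v, 0; rewrite scaler0 addr0. Qed.

Lemma ideal_smul_head x t v : ideal_smul (x :: t) (x *: v).
Proof. by exists 0, v; rewrite add0r; split=> //; apply: (submod0 (submod_ideal_smul t)). Qed.

Let notm (P : R -> Prop) := ~ forall y, m y -> P y.

(* Nakayama at [q] shows that [x] cannot divide, modulo [N], all the elements
   that [p] kills modulo [N]. *)
Lemma assoc_cons t x p q : prime_id q -> notm q -> assoc (ideal_smul t) p ->
  (forall a, p a -> q a) -> q x ->
  (forall v, ideal_smul t (x *: v) -> tors m (ideal_smul t) v) ->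
  exists Q, [/\ assoc (ideal_smul (x :: t)) Q, forall a, p a -> Q a, Q x & notm Q].
Proof.
set N := ideal_smul t; set N1 := ideal_smul (x :: t).
move=> pq mq [pp [v pv]] pq' qx xreg.
have sN : submod N by apply: submod_ideal_smul.
have sN1 : submod N1 by apply: submod_ideal_smul.
have NN1 u : N u -> N1 u by apply: ideal_smul_cons.
have sS := submod_sat pq sN; have sS1 := submod_sat pq sN1.
(* The elements that [p] kills in (V/N)_q; [v] is one of them. *)
pose U u := forall c, p c -> sat q N (c *: u).
have sU : submod U.
  split=> [c _|a u w Uu Uw c pc]; first by rewrite scaler0; apply: submod0.
  exact: (submod_scale c sS).2 (Uu c pc) (Uw c pc).
have [u [Uu nu]] : exists u, U u /\ ~ sat q N1 u.
  apply: contrapT => no; have [|h [qh hP]] := @nakayama_mul _ q _ pq N U x sN (noeV sU) qx.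
    move=> u Uu; have [h [qh [n [w [Nn e]]]]] : sat q N1 u.
      by apply: contrapT => nu; apply: no; exists u.
    exists h, n, w; split=> // c pc.
    (* The quotient [w] stays in [U]: c u and n vanish in (V/N)_q, and [x] is regular there. *)
    have [k [qk Nk]] : sat q N (x *: (c *: w)).
      have -> : x *: (c *: w) = h *: (c *: u) - c *: n.
        have -> : n = h *: u - x *: w by rewrite e addrK.
        by rewrite scalerBr opprB !scalerA [h * c]mulrC [x * c]mulrC addrC subrK.
      apply: (submodB sS); first exact: (submodZ _ sS (Uu c pc)).
      by apply: (sat_sub pq); apply: submodZ.
    have : tors m N (k *: (c *: w)).
      by apply: xreg; rewrite scalerA mulrC -scalerA.
    by move=> /(tors_sat pq mq)/(sat_idem pq qk).
  have Nhv : N (h *: v) by apply: hP => c /pv; apply: (sat_sub pq).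
  by apply: qh; apply: pq'; apply/pv.
(* This prime contains [p] because [u] is in [U], contains [x], and lies in [q]. Being finitely
   generated, it is also a colon modulo [N1] itself. *)
have [a pQ] := prime_colon noeR sS1 nu; set w := a *: u in pQ.
have [iQ Q1 Qp] := pQ.
have Qq c : sat q N1 (c *: w) -> q c.
  move=> Nc; apply: contrapT => nqc; apply: Q1.
  by rewrite scale1r; apply: sat_idem Nc.
pose Q c := sat q N1 (c *: w); exists Q; split.
- pose W y := exists c, Q c /\ y = c *: w.
  have [s sP] := noeth_ring noeR iQ.
  have sW : submod W.
    split; first by exists 0; split; [apply: (ideal0 iQ)|rewrite scale0r].
    move=> b _ _ [c [Qc ->]] [d [Qd ->]]; exists (b * c + d); split.
      by apply: (idealD iQ) => //; apply: (idealM iQ).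
    by rewrite scalerDl scalerA.
  have [|h [qh hP]] := sat_uniform pq sN1 (noeV sW); first by move=> _ [c [Qc ->]].
  apply: (@assoc_transfer _ _ N1 (sat q N1) _ w h) => //.
  + by move=> ?; apply: (sat_sub pq).
  + by move=> Qh; apply/qh/Qq.
  + by move=> c Qc; apply: hP; exists c.
- move=> c pc; rewrite /Q /w scalerA mulrC -scalerA; apply: (submodZ _ sS1).
  by have [k [qk Nk]] := Uu c pc; exists k; split=> //; apply: NN1.
- by apply: (sat_sub pq); apply: ideal_smul_head.
- by move=> mQ; apply: mq => y /mQ/Qq.
Qed.

(** * From the uniform bound to chains of primes above associated primes *)

Section UniformBound.
Variables (n T : nat).
Hypothesis bound : forall t, filter_regular t -> (size t < n)%N ->
  forall v, tors m (ideal_smul t) v -> mkill m T (ideal_smul t) v.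

(* If [p] had coheight one then the submodule [U] of the elements killed by [p]
   up to torsion would satisfy [x^T U <= x^(T+1) U] up to torsion. *)
Lemma assoc_coheight_gt1 t p : filter_regular t -> ((size t).+1 < n)%N ->
  assoc (ideal_smul t) p -> notm p ->
  exists q, [/\ prime_id q, forall a, p a -> q a, exists a, q a /\ ~ p a & notm q].
Proof.
set N := ideal_smul t => ft tn ap mp; apply: contrapT => no.
have [pp [v pv]] := ap; have [ip p1 ppM] := pp; have [im m1 mM] := pm.
have sN : submod N by apply: submod_ideal_smul.
have sN0 := submod_tors m sN.
have [|x [mx xQ]] := exists_nonzerodivisor (m := m) noeR noeV sN im.
  move=> Q _ mQ; apply: contrapT => noz; apply: mQ => z mz.
  by apply: contrapT => Qz; apply: noz; exists z.
have xreg k u : N (x ^+ k *: u) -> tors m N u.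
  apply: nonzerodivisor_up_to_tors => // Q aQ mQ /prime_exp Qx.
  by apply: (xQ Q aQ mQ); apply: Qx; have [] := aQ.
(* One power more than the bound [T], so that x^T can be cancelled below with a factor [x] to
   spare. *)
pose y := x ^+ T.+1; set N1 := ideal_smul (y :: t).
have sN1 : submod N1 by apply: submod_ideal_smul.
have NN1 u : N u -> N1 u by apply: ideal_smul_cons.
have fy : filter_regular (y :: t) by split=> // u; apply: xreg.
pose I : R -> Prop := fun c => exists a r, p a /\ c = a + r * y.
have iI : ideal I.
  split; first by exists 0, 0; rewrite mul0r addr0; split=> //; apply: (ideal0 ip).
  move=> b _ _ [a [r [pa ->]]] [a' [r' [pa' ->]]].
  exists (b * a + a'), (b * r + r'); split; last first.
    by rewrite -[_ *: _]/(b * (a + r * y)); ring.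
  by apply: (idealD ip) => //; apply: (idealM ip).
(* Without a prime strictly between [p] and [m], every prime containing p + (y) contains [m]; thus
   m^a lies in p + (y). *)
have [|a ka] := @radical_power R noeR m I iI.
  move=> Q pQ IQ c mc; apply: contrapT => Qc; apply: no; exists Q; split=> //.
  - by move=> b pb; apply: IQ; exists b, 0; rewrite mul0r addr0.
  - exists x; split; last exact: xQ.
    apply: (prime_exp (t := T.+1) pQ); apply: IQ.
    by exists 0, 1; rewrite mul1r add0r; split=> //; apply: (ideal0 ip).
  - by move=> mQ; apply: Qc; apply: mQ.
pose U u := forall c, p c -> tors m N (c *: u).
have sU : submod U.
  split=> [c _|b u w Uu Uw c pc]; first by rewrite scaler0; apply: submod0.
  exact: (submod_scale c sN0).2 (Uu c pc) (Uw c pc).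
have [|h [mh hP]] := @nakayama_mul _ m _ pm (tors m N) U x sN0 (noeV sU) mx.
  move=> u Uu.
  (* m^(a+T) sends [u] into [N1]: m^a lies in p + (y), the part p u is torsion modulo [N] and killed
     by m^T, and y u is in [N1]. Then the bound for (t, y) replaces a + T by [T]. *)
  have [n0 [w [Nn0 e]]] : N1 (x ^+ T *: u).
    apply: (mkill_exp mx); apply: bound => //; exists (a + T)%N; rewrite mkillD.
    have uZ (b c : R^o) : (b *: c : R) *: u = b *: ((c : R) *: u).
      exact: esym (scalerA _ _ _).
    rewrite -[u]scale1r -(mkill_preim m (mkill m T N1) a (1 : R^o) uZ).
    apply: mkill_mono ka => _ [b [r [pb ->]]].
    rewrite scalerDl; apply: (submodD (submod_mkill m T sN1)).
      by apply: mkill_mono (bound ft (ltnW tn) (Uu b pb)).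
    apply: (mkill_le sN1 (leq0n T)); rewrite /= mulrC -scalerA.
    exact: ideal_smul_head.
  have N0z : tors m N (u - x *: w).
    by apply: (xreg T); rewrite scalerBr scalerA -exprSr e addrK.
  (* It remains to see that [w] is again in [U], which follows by cancelling [x] up to torsion. *)
  exists 1, (u - x *: w), w; split=> //; last by rewrite scale1r subrK.
  move=> c pc; apply: (tors_cancel noeR (x := x) sN).
    by move=> z; apply: (xreg 1).
  rewrite scalerA mulrC -scalerA -[x *: w](subKr u) scalerBr.
  by apply: (submodB sN0); [apply: Uu|apply: submodZ].
have [k kv] : tors m N (h *: v).
  by apply: hP => c pc; apply: tors_sub; apply/pv.
apply: mp => z mz; apply: contrapT => pz; apply: mh; apply: (local ip p1).
have /ppM[/(prime_exp pp)//|//] : p (z ^+ k * h).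
by apply/pv; rewrite -scalerA; apply: mkill_exp kv.
Qed.

(** Take a prime [q] strictly between [p] and [m]. If an associated prime other than [m] contains
    [q], Noetherian induction applies to it. Otherwise [q] contains an element [x] that is filter
    regular on M/tM, and [assoc_cons] provides a strictly larger prime associated to M/(t, x)M, for
    one step less. *)
Lemma assoc_chain k t p : filter_regular t -> (size t + k <= n)%N ->
  assoc (ideal_smul t) p -> notm p -> chain k p.
Proof.
elim: k t p => [|k IHk] t p ft tk ap mp; first by case: ap.
(* Length one is the chain from [p] to [m]; a prime in between is needed only from length two on. *)
case: k => [|k] in IHk tk *.
  split; first by case: ap.
  exists m; split=> //; first by have [[ip p1 _] _] := ap; apply: local.
  apply: contrapT => no; apply: mp => y my.
  by apply: contrapT => py; apply: no; exists y.
have [ip _ _] := ap.1.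
move: p ip ap mp; apply: (noeth_wf (noeth_ring noeR)) => p ip IHp ap mp.
have tn : ((size t).+1 < n)%N by apply: leq_trans tk; rewrite !addnS !ltnS leq_addr.
have [q [pq pq' [b [qb pb]] mq]] := assoc_coheight_gt1 ft tn ap mp.
have [pp _] := ap.
have [[q' [aq' mq' qq']]|no] := pselect (exists q',
    [/\ assoc (ideal_smul t) q', notm q' & forall a, q a -> q' a]).
  apply: (@chain_sub R k.+2 p q') => //; first by move=> a /pq'/qq'.
  apply: (IHp q') => //; first by have [[]] := aq'.
    by move=> a /pq'/qq'.
  by exists b; split=> //; apply: qq'.
have sN := submod_ideal_smul t; have [iq q1 qM] := pq.
have [|x [qx xQ]] := exists_nonzerodivisor (m := m) noeR noeV sN iq.
  move=> Q aQ mQ; apply: contrapT => noz; apply: no; exists Q; split=> // z qz.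
  by apply: contrapT => Qz; apply: noz; exists z.
have xreg v : ideal_smul t (x *: v) -> tors m (ideal_smul t) v.
  exact: nonzerodivisor_up_to_tors.
have [Q [aQ pQ Qx mQ]] := assoc_cons pq mq ap pq' qx xreg.
split=> //; exists Q; split=> //; first by exists x; split=> //; apply: xQ.
by apply: (IHk (x :: t)) => //=; rewrite addSn -addnS.
Qed.

(** [k] counts the elements still missing for length [n]. The extension inside [p] is blocked only
    when [p] lies in an associated prime other than [m], and then [assoc_chain] makes up for the
    missing elements. *)
Lemma filter_regular_extend k t p : prime_id p -> notm p -> filter_regular t ->
  (forall x, x \in t -> p x) -> (size t + k = n)%N ->
  exists t' d, [/\ filter_regular t', forall x, x \in t' -> p x, chain d p
    & (n <= size t' + d)%N].
Proof.
move=> pp mp; elim: k t => [|k IH] t ft tp tk.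
  by exists t, 0; split=> //; rewrite tk.
have [[q [aq mq pq]]|no] := pselect (exists q,
    [/\ assoc (ideal_smul t) q, notm q & forall a, p a -> q a]).
  exists t, k.+1; split=> //; last by rewrite tk.
  by apply: (chain_sub pp pq); apply: (assoc_chain ft) => //; rewrite tk.
have sN := submod_ideal_smul t; have [ip _ _] := pp.
have [|x [px xQ]] := exists_nonzerodivisor (m := m) noeR noeV sN ip.
  move=> Q aQ mQ; apply: contrapT => noz; apply: no; exists Q; split=> // z qz.
  by apply: contrapT => Qz; apply: noz; exists z.
apply: (IH (x :: t)).
- by split=> // v; apply: nonzerodivisor_up_to_tors.
- by move=> y; rewrite inE => /orP[/eqP->|/tp].
- by rewrite /= addSn -addnS.
Qed.

End UniformBound.

End OneModule.
End FilterRegularSequences.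

(** * Absolutely pure modules and torsion *)

Section LinearSystems.
Variable R : comNzRingType.

Definition dot (P : finType) (V : lmodType R) (c : {ffun P -> R^o}) (f : P -> V) : V :=
  \sum_i (c i : R) *: f i.

Lemma dotP (P : finType) (V : lmodType R) (f : P -> V) a (c d : {ffun P -> R^o}) :
  dot (a *: c + d) f = a *: dot c f + dot d f.
Proof.
rewrite /dot scaler_sumr -big_split /=; apply: eq_bigr => i _.
by rewrite !ffunE scalerDl -scalerA.
Qed.

Lemma dot0 (P : finType) (V : lmodType R) (f : P -> V) : dot 0 f = 0.
Proof. by rewrite /dot big1 // => i _; rewrite ffunE scale0r. Qed.

Lemma dotZ (P : finType) (V : lmodType R) (f : P -> V) a (c : {ffun P -> R^o}) :
  dot (a *: c) f = a *: dot c f.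
Proof. by have := dotP f a c 0; rewrite dot0 !addr0. Qed.

Lemma dot_sum (P I : finType) (V : lmodType R) (f : P -> V) (c : I -> {ffun P -> R^o}) :
  dot (\sum_i c i) f = \sum_i dot (c i) f.
Proof.
apply: (big_morph (fun c => dot c f)); last exact: dot0.
by move=> a b; have := dotP f 1 a b; rewrite !scale1r.
Qed.

Lemma dotB (P : finType) (V : lmodType R) (f : P -> V) (c d : {ffun P -> R^o}) :
  dot (c - d) f = dot c f - dot d f.
Proof. by rewrite [c - d]addrC -[- d]scaleN1r dotP scaleN1r addrC. Qed.

Lemma submod_dot (P : finType) (V : lmodType R) (f : P -> V) (N : V -> Prop) :
  submod N -> submod (fun c => N (dot c f)).
Proof.
move=> sN; split; first by rewrite dot0; apply: submod0.
by move=> a c d Nc Nd; rewrite dotP; apply: sN.2.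
Qed.

Definition annihilates (P Q : finType) (A : P -> Q -> R) (c : {ffun P -> R^o}) : Prop :=
  forall j, \sum_i (c i : R) * A i j = 0.

Lemma submod_annihilates (P Q : finType) (A : P -> Q -> R) : submod (annihilates A).
Proof.
split=> [j|a c d cA dA j]; first by rewrite big1 // => i _; rewrite ffunE mul0r.
transitivity (a * (\sum_i (c i : R) * A i j) + \sum_i (d i : R) * A i j).
  rewrite mulr_sumr -big_split /=; apply: eq_bigr => i _.
  by rewrite !ffunE mulrDl -mulrA.
by rewrite cA dA mulr0 addr0.
Qed.

(* Every finite linear system that is consistent modulo [N] is solvable modulo
   [N]: the quotient by [N] is an absolutely pure module. *)
Definition pure (V : lmodType R) (N : V -> Prop) : Prop :=
  forall (P Q : finType) (A : P -> Q -> R) (f : P -> V),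
    (forall c, annihilates A c -> N (dot c f)) ->
    exists X : Q -> V, forall i, N (\sum_j A i j *: X j - f i).

Definition pure0 (V : lmodType R) : Prop := @pure V (fun v => v = 0).

Section Injective.
Variables (E : lmodType R) (P Q : finType) (A : P -> Q -> R) (f : P -> E).
Hypothesis consistent : forall c, annihilates A c -> dot c f = 0.

Let B : lmodType R := {ffun Q -> R^o}.

Definition comb (c : {ffun P -> R^o}) : B := [ffun j => \sum_i (c i : R) * A i j].

Lemma combP a c d : comb (a *: c + d) = a *: comb c + comb d.
Proof.
apply/ffunP => j; rewrite !ffunE.
transitivity (a * (\sum_i (c i : R) * A i j) + \sum_i (d i : R) * A i j); last by [].
rewrite mulr_sumr -big_split /=; apply: eq_bigr => i _.
by rewrite !ffunE mulrDl -mulrA.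
Qed.

Definition row_span : {pred B} := fun b => `[< exists c, b = comb c >].

Lemma row_span_submod_closed : submod_closed row_span.
Proof.
split; first by apply/asboolP; exists 0; apply/ffunP => j;
  rewrite !ffunE big1 // => i _; rewrite ffunE mul0r.
move=> a _ _ /asboolP[c ->] /asboolP[d ->].
by apply/asboolP; exists (a *: c + d); rewrite combP.
Qed.

HB.instance Definition _ := GRing.isSubmodClosed.Build R B row_span row_span_submod_closed.

Definition row_coef (b : submodule row_span) : {ffun P -> R^o} := projT1 (cid (asboolW (valP b))).

Lemma row_coefK b : comb (row_coef b) = val b.
Proof. by rewrite /row_coef; case: cid. Qed.

Lemma dot_comb c d : comb c = comb d -> dot c f = dot d f.
Proof.
move=> e; apply/eqP; rewrite -subr_eq0 addrC -scaleN1r -dotP; apply/eqP/consistent => j.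
have := combP (-1) d c; rewrite e [_ *: comb _]scaleN1r addNr => /ffunP/(_ j).
by rewrite !ffunE.
Qed.

Definition row_map (b : submodule row_span) : E := dot (row_coef b) f.

Lemma row_map_linear : linear row_map.
Proof.
by move=> a b c; rewrite /row_map -dotP; apply: dot_comb; rewrite combP !row_coefK.
Qed.

HB.instance Definition _ :=
  GRing.isLinear.Build R (submodule row_span) E *:%R row_map row_map_linear.

(** By consistency, sending the row combination cA to c f is well defined on the row span. An
    extension to the free module, evaluated on the basis, solves the system. *)
Lemma injective_solve : injective_module E ->
  exists X : Q -> E, forall i, \sum_j A i j *: X j - f i = 0.
Proof.
move=> /(_ (submodule row_span) B (val : {linear submodule row_span -> B})
  (row_map : {linear submodule row_span -> E}) val_inj)[h hP].
exists (fun j => h [ffun k => (k == j)%:R]) => i; apply/eqP; rewrite subr_eq0; apply/eqP.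
pose e : {ffun P -> R^o} := [ffun k => (k == i)%:R].
have de (W : lmodType R) (g : P -> W) : dot e g = g i.
  rewrite /dot (bigD1 i) //= ffunE eqxx scale1r big1 ?addr0 // => k ki.
  by rewrite ffunE (negPf ki) scale0r.
have se : comb e \in row_span by apply/asboolP; exists e.
have hE b : h (val b) = dot (row_coef b) f := hP b.
have := hE (Sub (comb e) se); rewrite (dot_comb (d := e)); last by rewrite row_coefK SubK.
rewrite de SubK => <-.
have -> : comb e = \sum_j A i j *: ([ffun k => (k == j)%:R] : B).
  apply/ffunP => j; rewrite sum_ffunE ffunE [LHS](de R^o (fun i => A i j)).
  rewrite (bigD1 j) //= !ffunE eqxx [_ *: _]mulr1 big1 ?addr0 // => k kj.
  by rewrite !ffunE eq_sym (negPf kj) [_ *: _]mulr0.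
by rewrite linear_sum; apply: eq_bigr => j _; rewrite linearZ.
Qed.

End Injective.

Lemma pure0_injective (E : lmodType R) : injective_module E -> pure0 E.
Proof. by move=> injE P Q A f fP; apply: injective_solve. Qed.

Lemma pure0_trivial (V : lmodType R) : (forall v : V, v = 0) -> pure0 V.
Proof. by move=> V0 P Q A f _; exists (fun=> 0) => i. Qed.

Lemma pure0_prod (V W : lmodType R) : pure0 V -> pure0 W -> pure0 (V * W)%type.
Proof.
move=> pV pW P Q A f fP.
have fstS (I : finType) (F : I -> V * W) : (\sum_i F i).1 = \sum_i (F i).1.
  exact: (big_morph fst (fun _ _ => erefl) erefl).
have sndS (I : finType) (F : I -> V * W) : (\sum_i F i).2 = \sum_i (F i).2.
  exact: (big_morph snd (fun _ _ => erefl) erefl).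
have [c cA|X XP] := pV P Q A (fun i => (f i).1).
  by have := congr1 fst (fP c cA); rewrite fstS.
have [c cA|Y YP] := pW P Q A (fun i => (f i).2).
  by have := congr1 snd (fP c cA); rewrite sndS.
exists (fun j => (X j, Y j)) => i; apply: injective_projections => /=.
  by rewrite fstS /= XP.
by rewrite sndS /= YP.
Qed.

End LinearSystems.

Section PureTorsion.
Variables (R : comNzRingType) (m : R -> Prop).
Hypothesis noeR : noetherian R.

(* [Q] is maximal with [Q :&: L = L0]; for [x] in [m] the chain of the colons
   [Q : x^t] is stationary, so maximality puts a power of [x] times [F] in [Q]. *)
Lemma artin_rees (F : lmodType R) (L L0 : F -> Prop) : noeth_mod F ->
  submod L -> submod L0 -> (forall c, L0 c -> L c) ->
  (forall c, L c -> tors m L0 c) ->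
  exists Q, [/\ submod Q, forall c, Q c -> L c -> L0 c
    & forall x, m x -> exists t, forall c, Q (x ^+ t *: c)].
Proof.
move=> noeF sL sL0 L0L Lt.
suff H : forall Q, submod Q -> (forall c, L0 c -> Q c) -> (forall c, Q c -> L c -> L0 c) ->
    exists Q, [/\ submod Q, forall c, Q c -> L c -> L0 c
      & forall x, m x -> exists t, forall c, Q (x ^+ t *: c)].
  exact: (H L0).
apply: (noeth_wf noeF) => Q sQ IH L0Q QL.
have [[x [mx xP]]|no] := pselect (exists x,
    m x /\ forall t, exists c, ~ Q (x ^+ t *: c)); last first.
  exists Q; split=> // x mx; apply: contrapT => not; apply: no; exists x; split=> // t.
  by apply: contrapT => noc; apply: not; exists t => c; apply: contrapT => nQ; apply: noc; exists c.
have sT := submod_tors (fun y => y = x) sQ.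
have [t tP] := tors_uniform sQ (noeF _ sT) (fun u (Hu : tors (fun y => y = x) Q u) => Hu).
have tE k c : mkill (fun y => y = x) k Q c <-> Q (x ^+ k *: c).
  elim: k c => [|k IHk] c /=; first by rewrite expr0 scale1r.
  by rewrite exprSr -scalerA -IHk; split=> [/(_ _ erefl)|H _ ->].
pose Q' := sum_submod Q (fun v => exists c, v = x ^+ t *: c).
have sQ' : submod Q'.
  apply: submod_sum_submod => //; split; first by exists 0; rewrite scaler0.
  move=> a _ _ [c ->] [d ->]; exists (a *: c + d).
  by rewrite scalerDr !scalerA mulrC.
have QQ' c : Q c -> Q' c.
  by move=> Qc; exists c, 0; split; rewrite ?addr0 //; exists 0; rewrite scaler0.
have [c Qc] := xP t; apply: (IH Q' sQ' QQ') => //.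
- exists (x ^+ t *: c); split=> //; exists 0, (x ^+ t *: c); rewrite add0r.
  by split=> //; [apply: submod0|exists c].
- by move=> d /L0Q/QQ'.
(* A power x^k puts the element in [L0], hence in [Q], so x^(k+t) d is in [Q]; by the choice of [t]
   already x^t d is. *)
- move=> _ [q [_ [Qq [d ->] ->]]] Ly; apply: (QL _ _ Ly).
  apply: submodD => //; apply/tE/tP.
  have [k /(mkill_exp mx)/L0Q] := Lt _ Ly.
  rewrite scalerDr => H; exists (k + t)%N; apply/tE.
  by have := submodB sQ H (submodZ (x ^+ k) sQ Qq); rewrite addrC addKr scalerA -exprD.
Qed.

Variables (V : lmodType R).
Let zero : V -> Prop := fun v => v = 0.

(** A system consistent modulo torsion becomes exactly consistent after subtracting a torsion vector
    [gam] from the right-hand side. [gam] agrees with [f] on relations and vanishes on the submodule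
    [S] from [artin_rees]; it is torsion because powers of each x in [m] carry the basis into
    [S]. *)
Lemma pure_tors : pure0 V -> pure (tors m zero).
Proof.
move=> pV P Q A f fP.
have noeF := @noeth_ffun R noeR P.
pose L := annihilates A; pose L0 c := L c /\ dot c f = 0.
have sL : submod L by apply: submod_annihilates.
have sD : submod (fun c => dot c f = 0) by exact: (submod_dot f (submod_zero V)).
have sL0 : submod L0 by exact: (submodI sL sD).
have [||S [sS SL Sx]] := artin_rees noeF sL sL0; first by move=> c [].
  move=> c Lc; have [T kT] := fP c Lc; exists T.
  have : mkill m T (fun c => dot c f = 0) c.
    by rewrite (mkill_preim m zero T c (dotZ f)).
  elim: T {kT} c Lc => [|T IHT] c Lc //= kc x /kc; apply: IHT.
  exact: (submodZ x sL Lc).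
(* The map [l + q |-> dot l f] on [L + S] extends to the whole free module. *)
have sLS := submod_sum_submod sL sS; have [s sP] := noeF _ sLS.
have ls (k : 'I_(size s)) : exists l, L l /\ S (s`_k - l).
  have /sP[l [q [Ll Sq ->]]] : span s s`_k by apply/span_mem/mem_nth.
  by exists l; rewrite addrC addKr.
have {ls}[l lP] := choice ls.
have [d dA|gam gamP] := pV 'I_(size s) P (fun k i => s`_k i) (fun k => dot (l k) f).
  have Ll k : L (d k *: l k) by apply: (submodZ _ sL); case: (lP k).
  have Lsum : L (\sum_k d k *: l k) by apply: (submod_sum sL).
  have -> : dot d (fun k => dot (l k) f) = dot (\sum_k d k *: l k) f.
    by rewrite dot_sum; apply: eq_bigr => k _; rewrite dotZ.
  have [] // : L0 (\sum_k d k *: l k).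
  apply: SL => //; rewrite -[X in S X]opprK; apply: submodN => //.
  have -> : - (\sum_k d k *: l k) = \sum_k d k *: (s`_k - l k).
    have s0 : \sum_k (d k : R) *: s`_k = 0.
      apply/ffunP => i; rewrite sum_ffunE ffunE -[RHS](dA i).
      by apply: eq_bigr => k _; rewrite ffunE.
    transitivity (\sum_k (d k : R) *: s`_k - \sum_k d k *: l k); first by rewrite s0 sub0r.
    by rewrite -sumrB; apply: eq_bigr => k _; rewrite scalerBr.
  by apply: submod_sum => // k; apply: submodZ => //; case: (lP k).
have gE c q : L c -> S q -> dot (c + q) gam = dot c f.
  move=> Lc Sq; have /spanE[d e] : span s (c + q) by apply/sP; exists c, q.
  have [c' [q' [Lc' Sq' ec dc]]] : exists c' q', [/\ L c', S q', c + q = c' + q'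
      & dot (c + q) gam = dot c' f].
    exists (\sum_(k < size s) d k *: l k), (\sum_(k < size s) d k *: (s`_k - l k)).
    split=> //.
    - by apply: (submod_sum sL) => k; apply: (submodZ _ sL); case: (lP k).
    - by apply: (submod_sum sS) => k; apply: (submodZ _ sS); case: (lP k).
    - by rewrite e -big_split /=; apply: eq_bigr => k _; rewrite -scalerDr addrC subrK.
    rewrite e !dot_sum; apply: eq_bigr => k _; rewrite !dotZ; congr (_ *: _).
    by apply/eqP; rewrite -subr_eq0; apply/eqP/gamP.
  rewrite dc; apply/eqP; rewrite -subr_eq0 -dotB; apply/eqP.
  have [] // : L0 (c' - c); apply: SL; last exact: (submodB sL).
  have -> : c' - c = q - q'; last exact: (submodB sS).
  by apply/eqP; rewrite subr_eq addrAC eq_sym subr_eq addrC ec addrC.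
have [c cA|X XP] := pV P Q A (fun i => f i - gam i).
  have -> : dot c (fun i => f i - gam i) = dot c f - dot c gam.
    by rewrite /dot -sumrB; apply: eq_bigr => i _; rewrite scalerBr.
  by rewrite -(gE c 0) ?addr0 ?subrr //; apply: submod0 sS.
exists X => i; have gt : tors m zero (gam i).
  apply: (tors_exp noeR (submod_zero V)) => x mx; have [t St] := Sx x mx; exists t.
  pose e : {ffun P -> R^o} := [ffun k => (k == i)%:R].
  have <- : dot e gam = gam i.
    rewrite /dot (bigD1 i) //= ffunE eqxx scale1r big1 ?addr0 // => k ki.
    by rewrite ffunE (negPf ki) scale0r.
  rewrite -dotZ -[_ *: e]add0r gE //; [exact: dot0|exact: submod0 sL].
have -> : \sum_j A i j *: X j - f i = - gam i.
  by apply/eqP; rewrite -addr_eq0 -[X in _ == X](XP i) opprB addrA addrAC.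
by apply: submodN => //; apply: submod_tors; apply: submod_zero.
Qed.
End PureTorsion.

(** * Koszul complexes on a resolution *)

Section Complexes.
Variable R : comNzRingType.

Record complex := Complex {
  cob :> nat -> lmodType R;
  cdiff : forall l, {linear cob l -> cob l.+1};
  cdiff2 : forall l v, cdiff l.+1 (cdiff l v) = 0
}.

(* The differential into degree [l], which is zero for [l = 0]. *)
Definition dpred (K : complex) (l : nat) : {linear K l.-1 -> K l} :=
  match l return {linear K l.-1 -> K l} with
  | 0 => \0 : {linear K 0 -> K 0}
  | l'.+1 => cdiff K l'
  end.

Lemma cdiff_dpred (K : complex) l v : cdiff K l (dpred K l v) = 0.
Proof. by case: l v => [|l] v /=; rewrite ?linear0 // cdiff2. Qed.

Section Cone.
Variables (K : complex) (x : R).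

(** In degree 0 the second factor is [K 0] in place of the zero module; the complexes used below
    vanish in degree 0, so this is the Koszul cone of multiplication by [x]. *)
Definition cone_ob (l : nat) : lmodType R := (K l * K l.-1)%type.

Definition cone_fun l (p : cone_ob l) : cone_ob l.+1 :=
  (cdiff K l p.1, x *: p.1 - dpred K l p.2).

Lemma cone_fun_linear l : linear (@cone_fun l).
Proof.
move=> a [u v] [u' v']; rewrite /cone_fun /=; congr (_, _); first by rewrite linearP.
rewrite [dpred K l _]linearP /= scalerDr.
rewrite -[RHS]/(a *: (x *: u - dpred K l v) + (x *: u' - dpred K l v')).
by rewrite scalerBr !scalerA mulrC opprD addrACA.
Qed.

HB.instance Definition _ l :=
  GRing.isLinear.Build R (cone_ob l) (cone_ob l.+1) *:%R (@cone_fun l) (@cone_fun_linear l).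

Lemma cone_fun2 l p : @cone_fun l.+1 (@cone_fun l p) = 0.
Proof.
rewrite /cone_fun /= cdiff2 linearB /= linearZ /= cdiff_dpred subr0 subrr.
by [].
Qed.

Definition cone : complex :=
  @Complex cone_ob (fun l => @cone_fun l : {linear cone_ob l -> cone_ob l.+1}) cone_fun2.

Lemma cdiff_cone l v w : cdiff cone l (v, w) = (cdiff K l v, x *: v - dpred K l w).
Proof. by []. Qed.

Lemma cone_cocycle l v w :
  cdiff cone l (v, w) = 0 <-> cdiff K l v = 0 /\ dpred K l w = x *: v.
Proof.
rewrite cdiff_cone; split=> [[-> /eqP]|[-> ->]]; last by rewrite subrr.
by rewrite subr_eq0 => /eqP ->.
Qed.

End Cone.
End Complexes.

(** * Boundaries, torsion, and the effect of a cone on cohomology *)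

Section Boundaries.
Variables (R : comNzRingType) (m : R -> Prop).
Hypothesis noeR : noetherian R.

Definition all_elts (V : lmodType R) (v : V) : Prop := True.

Definition gamma (V : lmodType R) (v : V) : Prop := tors m (fun u => u = 0) v.

Lemma submod_gamma (V : lmodType R) : submod (@gamma V).
Proof. exact: submod_tors (submod_zero V). Qed.

Lemma gamma_linear (V W : lmodType R) (f : {linear V -> W}) v : gamma v -> gamma (f v).
Proof.
move=> [T kv]; exists T.
rewrite -(mkill_preim m (fun u => u = 0) T v (fun a u => linearZ_LR f a u)).
by apply: mkill_mono kv => _ ->; rewrite linear0.
Qed.

Lemma gamma_pair (V W : lmodType R) (v : V) (w : W) :
  @gamma (V * W)%type (v, w) <-> gamma v /\ gamma w.
Proof.
split=> [g|[[S kv] [T kw]]].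
  by split; [exact: (gamma_linear fst g)|exact: (gamma_linear snd g)].
exists (maxn S T).
have := mkill_le (submod_zero W) (leq_maxr S T) kw.
have := mkill_le (submod_zero V) (leq_maxl S T) kv.
elim: (maxn S T) v w {kv kw} => [|k IH] v w /=; first by move=> -> ->.
by move=> kv kw y my; apply: IH; [apply: kv|apply: kw].
Qed.

Section Bdry.
Variable G : forall V : lmodType R, V -> Prop.
Hypothesis sG : forall V : lmodType R, submod (@G V).
Hypothesis G_pair : forall (V W : lmodType R) (v : V) (w : W),
  @G (V * W)%type (v, w) <-> G v /\ G w.

(** [G] is [all_elts] for the boundaries of [K] and [gamma] for those of its torsion subcomplex. *)
Definition bdry (K : complex R) (l : nat) (v : K l) : Prop :=
  exists2 w, G w & v = dpred K l w.

Lemma submod_bdry K l : submod (@bdry K l).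
Proof.
split; first by exists 0; [apply: submod0|rewrite linear0].
move=> a _ _ [u Gu ->] [v Gv ->]; exists (a *: u + v); first exact: (sG _).2.
by rewrite linearP.
Qed.

Lemma bdry_cone_inr (K : complex R) x l (w : K l) : bdry w -> @bdry (cone K x) l.+1 (0, w).
Proof.
move=> [z Gz ->]; exists (0, - z).
  by apply/G_pair; split; [apply: submod0|apply: submodN].
by rewrite /= /cone_fun /= linear0 scaler0 linearN sub0r opprK.
Qed.

(** Effective exactness of H^l(K) -> H^(l+1)(cone) -> H^(l+1)(K): once [v] is the boundary of y,
    subtracting the boundary of (y, 0) leaves (0, w - x y), whose second entry is a cocycle. *)
Lemma cone_kill (K : complex R) x T l (L : K l -> Prop) (L' : cone K x l.+1 -> Prop) v w :
  submod L' -> (forall p, bdry p -> L' p) -> (forall w', L w' -> L' (0, w')) ->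
  (forall w', G w' -> cdiff K l w' = 0 -> L w') ->
  mkill m T (@bdry K l.+1) v -> G w -> cdiff (cone K x) l.+1 (v, w) = 0 ->
  mkill m T L' (v, w).
Proof.
move=> sL' BL' LL' GL; elim: T v w => [|T IH] v w; last first.
  move=> kv Gw dvw y my; apply: IH; [exact: kv|exact: submodZ|].
  by rewrite -[(_, _)]/(y *: (v, w)) linearZ_LR dvw scaler0.
move=> [y Gy ->] Gw /cone_cocycle[_ dw].
have -> : (dpred K l.+1 y, w) = cone_fun x (y, 0) + (0, w - x *: y) :> cone_ob K l.+1.
  by rewrite /cone_fun /= linear0 subr0; congr (_, _); rewrite /= ?addr0 // addrC subrK.
apply: submodD => //.
  by apply: BL'; exists (y, 0) => //; apply/G_pair; split=> //; apply: submod0.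
apply/LL'/GL; first by apply: submodB => //; apply: submodZ.
by rewrite linearB linearZ /= -[cdiff K l w]/(dpred K l.+1 w) dw subrr.
Qed.

End Bdry.

Variable M : lmodType R.

(* What is needed of the Koszul complex on a filter regular sequence [t] of
   length [j] with coefficients in an injective resolution placed in degrees
   [>= 1]: the cohomology is torsion in degrees at most [j], and it is
   [M / N], [N = t M], in degree [j + 1]. *)
Record koszul_like (K : complex R) (j : nat) (N : M -> Prop)
    (iota : {linear M -> K j.+1}) : Prop := {
  kl_zero : forall v : K 0, v = 0;
  kl_pure : forall l, pure0 (K l);
  kl_low : forall l, (l <= j)%N -> forall v : K l, cdiff K l v = 0 ->
    tors m (@bdry all_elts K l) v;
  kl_cocycle : forall u, cdiff K j.+1 (iota u) = 0;
  kl_surj : forall v : K j.+1, cdiff K j.+1 v = 0 ->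
    exists u w, v = iota u + cdiff K j w;
  kl_ker : forall u, (exists w, iota u = cdiff K j w) <-> N u;
  kl_high : forall l, (j < l)%N -> forall v : K l.+1, cdiff K l.+1 v = 0 ->
    exists w, v = cdiff K l w
}.

Section ConeIota.
Variables (K : complex R) (x : R) (j : nat) (iota : {linear M -> K j.+1}).

Definition cone_iota (u : M) : cone K x j.+2 := (0, iota u).

Lemma cone_iota_linear : linear cone_iota.
Proof.
by move=> a u v; rewrite /cone_iota linearP; congr (_, _); rewrite /= scaler0 addr0.
Qed.

HB.instance Definition _ :=
  GRing.isLinear.Build R M (cone K x j.+2) *:%R cone_iota cone_iota_linear.

End ConeIota.

(** Multiplication by [x] on M/N, the cohomology in degree j + 1, has torsion kernel by filter
    regularity, which keeps the low cohomology torsion. Its cokernel M/(N + xM) becomes the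
    cohomology in degree j + 2. *)
Lemma koszul_cone K x j N iota : submod N ->
  (forall v, N (x *: v) -> tors m N v) -> @koszul_like K j N iota ->
  @koszul_like (cone K x) j.+1 (fun v => exists n w, N n /\ v = n + x *: w)
    (cone_iota x iota : {linear M -> cone K x j.+2}).
Proof.
move=> sN xreg [zeroK pureK lowK cocK surjK kerK highK].
have sall (V : lmodType R) : submod (@all_elts V) by [].
split.
- by move=> [v w]; rewrite (zeroK v) (zeroK w).
- by move=> l; apply: pure0_prod.
- case=> [|l] lj [v w] dvw.
    by exists 0, 0 => //; rewrite (zeroK v) (zeroK w) linear0.
  have /cone_cocycle[dv dw] := dvw.
  have [T kT] : tors m (@bdry all_elts K l.+1) v.
    (* Only the new degree l = j uses [xreg]: there [v] is the class of some [u] with x u in [N]. *)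
    move: lj; rewrite ltnS leq_eqVlt => /orP[/eqP e|lj]; last exact: lowK.
    subst l; have [u [z vE]] := surjK v dv.
    have /xreg[T kT] : N (x *: u).
      apply/kerK; exists (w - x *: z).
      by rewrite linearZ linearB linearZ /= -[cdiff K j w]/(dpred K j.+1 w) dw vE scalerDr addrK.
    exists T; rewrite vE; apply: submodD; first exact: submod_mkill (submod_bdry _ _ _).
      rewrite -(mkill_preim m _ T u (fun a u => linearZ_LR iota a u)).
      by apply: mkill_mono kT => n /kerK[y ->]; exists y.
    by apply: (mkill_le (submod_bdry sall _ _) (leq0n T)); exists z.
  apply: tors_idem => //; first exact: submod_bdry.
  exists T.
  apply: (cone_kill (G := all_elts) (L := tors m (@bdry all_elts K l)) _ _ _ _ _ _ kT _ dvw) => //.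
  + exact: (submod_tors m (submod_bdry sall _ _)).
  + by move=> p Bp; apply: tors_sub.
  + move=> w' [S kS]; exists S.
    pose inr w : cone K x l.+1 := (0, w).
    have inrZ a u : inr (a *: u) = a *: inr u.
      by rewrite /inr; congr (_, _); rewrite /= scaler0.
    rewrite -[(0, w')]/(inr w') -(mkill_preim m _ S w' inrZ).
    by apply: mkill_mono kS => z; apply: bdry_cone_inr.
  + by move=> w' _ dw'; apply: lowK => //; apply: ltnW.
- by move=> u; apply/cone_cocycle; rewrite linear0 scaler0; split=> //; apply: cocK.
- move=> [v w] /cone_cocycle[dv dw].
  have [y vE] := highK j.+1 (ltnSn j) v dv.
  have [|u [z wE]] := surjK (w - x *: y).
    by rewrite linearB linearZ /= -[cdiff K _ w]/(dpred K j.+2 w) dw vE subrr.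
  exists u, (y, - z); rewrite cdiff_cone /= linearN opprK -vE /cone_iota.
  rewrite -[RHS]/(0 + v, iota u + (x *: y + cdiff K j z)) add0r; congr (_, _).
  by rewrite addrCA -wE addrC subrK.
- move=> u; split=> [[[v w]]|[n [u' [/kerK[z nE] ->]]]].
    rewrite cdiff_cone => -[dv uE]; have [u' [z vE]] := surjK v (esym dv).
    exists (u - x *: u'), u'; rewrite subrK; split=> //; apply/kerK.
    exists (x *: z - w).
    rewrite !linearB !linearZ /= uE vE scalerDr.
    rewrite -[dpred K j.+1 w]/(cdiff K j w) addrAC.
    by rewrite scalerN [x *: iota u' + _]addrC addrK.
  exists (iota u', - z); rewrite cdiff_cone cocK; congr (_, _).
  by rewrite linearN opprK linearD linearZ /= nE addrC.
- case=> // l lj [v w] /cone_cocycle[dv dw].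
  have [y vE] := highK l.+1 (ltnW lj) v dv.
  have [|z wE] := highK l lj (w - x *: y).
    by rewrite linearB linearZ /= -[cdiff K _ w]/(dpred K l.+2 w) dw vE subrr.
  exists (y, - z); rewrite cdiff_cone -vE; congr (_, _).
  by rewrite linearN opprK -[dpred K l.+1 z]/(cdiff K l z) -wE addrC subrK.
Qed.

(** Both neighbours in the exact sequence of the cone of the torsion subcomplex are killed by m^T,
    so the middle is killed by m^(2T), whatever [x] is. *)
Lemma cone_gamma_kill (K : complex R) x n T : (forall v : K 0, v = 0) ->
  (forall l, (l <= n)%N -> forall v : K l, gamma v -> cdiff K l v = 0 ->
     mkill m T (@bdry (@gamma) K l) v) ->
  forall l, (l <= n)%N -> forall v : cone K x l, gamma v -> cdiff (cone K x) l v = 0 ->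
     mkill m (T + T) (@bdry (@gamma) (cone K x) l) v.
Proof.
move=> zeroK kK [|l] ln [v w] /gamma_pair[gv gw] dvw.
  have sB := submod_bdry (G := @gamma) submod_gamma (cone K x) 0.
  rewrite (zeroK v) (zeroK w); exact: (submod0 (submod_mkill m (T + T) sB)).
have sB := submod_bdry (G := @gamma) submod_gamma (cone K x) l.+1.
rewrite mkillD.
apply: (cone_kill (G := gamma) (L := mkill m T (@bdry (@gamma) K l)) _ _ _ _ _ _ _ gw dvw).
- exact: submod_gamma.
- exact: gamma_pair.
- exact: submod_mkill.
- by move=> p Bp; apply: (mkill_le sB (leq0n T)).
- move=> w' kS; pose inr w : cone K x l.+1 := (0, w).
  have inrZ a u : inr (a *: u) = a *: inr u.
    by rewrite /inr; congr (_, _); rewrite /= scaler0.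
  rewrite -[(0, w')]/(inr w') -(mkill_preim m _ T w' inrZ).
  by apply: mkill_mono kS => z; apply: bdry_cone_inr; [exact: submod_gamma|exact: gamma_pair].
- by move=> w' gw' dw'; apply: kK => //; apply: ltnW.
- by apply: kK => //; have /cone_cocycle[] := dvw.
Qed.

(** * Splitting of the complex modulo torsion *)

Section Splitting.
Hypothesis im : ideal m.

(** The preimage in [K l] of the boundaries of K modulo its torsion. *)
Definition tors_bdry (K : complex R) (l : nat) : K l -> Prop :=
  sum_submod (@gamma (K l)) (@bdry all_elts K l).

Lemma submod_all_bdry (K : complex R) l : submod (@bdry all_elts K l).
Proof. exact: submod_bdry. Qed.

Lemma submod_tors_bdry (K : complex R) l : submod (@tors_bdry K l).
Proof. exact: (submod_sum_submod (submod_gamma _) (submod_all_bdry _ _)). Qed.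

Lemma tors_bdryS (K : complex R) l (v : K l.+1) :
  tors_bdry v <-> exists w, gamma (v - cdiff K l w).
Proof.
split=> [[z [_ [gz [w _ ->] ->]]]|[w gw]]; first by exists w; rewrite addrK.
by exists (v - cdiff K l w), (cdiff K l w); split; [|exists w|rewrite subrK].
Qed.

Section Step.
Variables (K : complex R) (l : nat).
Hypothesis pureN : pure (@tors_bdry K l).
Hypothesis satN : forall v : K l, tors m (@tors_bdry K l) v -> tors_bdry v.
Hypothesis torsH : forall v : K l, cdiff K l v = 0 -> tors m (@bdry all_elts K l) v.

(** Exactness of K modulo torsion in degree [l]: [K l] modulo [tors_bdry] embeds in [K l.+1] modulo
    torsion. *)
Lemma gamma_cdiff (v : K l) : gamma (cdiff K l v) <-> tors_bdry v.
Proof.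
split=> [[T]|[z [_ [gz [w _ ->] ->]]]]; last first.
  by rewrite linearD cdiff_dpred addr0; apply: gamma_linear.
rewrite -(mkill_preim m (fun u => u = 0) T v (fun a u => linearZ_LR (cdiff K l) a u)) => kv.
have /tors_idem : tors m (tors m (@bdry all_elts K l)) v.
  by exists T; apply: mkill_mono kv => u /torsH.
move=> /(_ noeR (submod_all_bdry _ _)) tv; apply: satN; apply: tors_mono tv => u Bu.
by exists 0, u; rewrite add0r; split=> //; apply: (submod0 (submod_gamma _)).
Qed.

(** For generators g_k of [m], the elements g_k^T v are boundaries d w_k up to torsion. Purity one
    degree lower solves g_k^T X = w_k, and then v - d X is torsion. *)
Lemma tors_bdry_sat (v : K l.+1) : tors m (@tors_bdry K l.+1) v -> tors_bdry v.
Proof.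
move=> [T kv]; have [g gP] := noeth_ring noeR im.
have sg := submod_gamma.
have exw (k : 'I_(size g)) : exists w, gamma ((g`_k : R) ^+ T *: v - cdiff K l w).
  by apply/tors_bdryS/(mkill_exp _ kv)/gP/span_mem/mem_nth.
have [w wP] := choice exw.
have [c cA|X XP] := pureN (A := fun (k : 'I_(size g)) (_ : 'I_1) => (g`_k : R) ^+ T) (f := w).
  apply/gamma_cdiff; have -> : cdiff K l (dot c w) =
      - dot c (fun k => (g`_k : R) ^+ T *: v - cdiff K l (w k)).
    transitivity ((\sum_k c k * (g`_k : R) ^+ T) *: v -
        dot c (fun k => (g`_k : R) ^+ T *: v - cdiff K l (w k))).
      rewrite /dot linear_sum scaler_suml -sumrB; apply: eq_bigr => k _.
      by rewrite linearZ -scalerA scalerBr subKr.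
    by rewrite (cA ord0) scale0r sub0r.
  by apply: (submodN (sg _)); apply: (submod_sum (sg _)) => k; apply: (submodZ _ (sg _)).
apply/tors_bdryS; exists (X ord0); apply: (tors_idem noeR (submod_zero _)).
apply: (tors_gen noeR (g := g) (sg _)) => [x /gP//|x xg]; exists T.
have kg : (index x g < size g)%N by rewrite index_mem.
have := wP (Ordinal kg); have /gamma_cdiff := XP (Ordinal kg).
rewrite big_ord1 /= nth_index // => gd gw.
have := submodB (sg _) gw gd; rewrite linearB linearZ /= scalerBr opprB.
by rewrite addrA subrK.
Qed.

(** A quotient of an absolutely pure module by an absolutely pure submodule: purity in degree [l]
    corrects the right-hand side by a boundary d y, making it consistent modulo torsion, and
    [pure_tors] solves the rest. *)
Lemma tors_bdry_pure : pure0 (K l.+1) -> pure (@tors_bdry K l.+1).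
Proof.
move=> pK P Q A f fP; have sg := submod_gamma.
have [s sP] := noeth_ffun noeR (submod_annihilates A).
have exw (k : 'I_(size s)) : exists w, gamma (dot s`_k f - cdiff K l w).
  by apply/tors_bdryS/fP/sP/span_mem/mem_nth.
have [w wP] := choice exw.
have [e eA|y yP] := pureN (A := fun (k : 'I_(size s)) i => s`_k i : R) (f := w).
  apply/gamma_cdiff; have -> : cdiff K l (dot e w) =
      - dot e (fun k => dot s`_k f - cdiff K l (w k)).
    have e0 : \sum_k (e k : R) *: s`_k = 0.
      apply/ffunP => i; rewrite sum_ffunE ffunE -[RHS](eA i).
      by apply: eq_bigr => k _; rewrite ffunE.
    transitivity (dot (\sum_k (e k : R) *: s`_k) f -
        dot e (fun k => dot s`_k f - cdiff K l (w k))); last by rewrite e0 dot0 sub0r.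
    rewrite dot_sum /(dot e) linear_sum -sumrB; apply: eq_bigr => k _.
    by rewrite linearZ dotZ scalerBr subKr.
  by apply: (submodN (sg _)); apply: (submod_sum (sg _)) => k; apply: (submodZ _ (sg _)).
have pT : pure (@gamma (K l.+1)) by apply: pure_tors.
have [c cA|X XP] := pT P Q A (fun i => f i - cdiff K l (y i)).
  apply: (span_min (submod_dot _ (sg _)) _ (iffLR (sP c) cA)) => c' c's.
  have ks : (index c' s < size s)%N by rewrite index_mem.
  have := wP (Ordinal ks); have /gamma_cdiff := yP (Ordinal ks).
  rewrite /= nth_index // => gd gw; have := submodB (sg _) gw gd.
  rewrite linearB linear_sum /= opprB addrA subrK /dot -sumrB.
  by under eq_bigr do rewrite linearZ -scalerBr.
exists X => i; apply/tors_bdryS; exists (- y i); rewrite linearN opprK.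
by rewrite addrAC -addrA -(opprB (f i)); apply: XP.
Qed.

End Step.

(* Modulo torsion and boundaries each term remains torsion free and absolutely
   pure, as for a split exact complex of torsion-free injective modules. *)
Lemma torsion_boundary_split (K : complex R) i : (forall v : K 0, v = 0) ->
  (forall l, pure0 (K l)) ->
  (forall l, (l < i)%N -> forall v : K l, cdiff K l v = 0 -> tors m (@bdry all_elts K l) v) ->
  forall v : K i, tors m (@bdry all_elts K i) v -> tors_bdry v.
Proof.
move=> zeroK pureK lowK.
suff H : forall l, (l <= i)%N -> pure (@tors_bdry K l) /\
    forall v : K l, tors m (@tors_bdry K l) v -> tors_bdry v.
  move=> v tv; apply: (H i (leqnn i)).2; apply: tors_mono tv => u Bu.
  by exists 0, u; rewrite add0r; split=> //; apply: (submod0 (submod_gamma _)).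
elim=> [|l IH] li.
  have N0 v : @tors_bdry K 0 v by rewrite (zeroK v); apply: (submod0 (submod_tors_bdry K 0)).
  by split=> // P Q A f _; exists (fun=> 0).
have [pN sN] := IH (ltnW li); have tH := lowK l li.
by split; [apply: tors_bdry_pure|apply: tors_bdry_sat].
Qed.

(** The splitting writes [iota u] as a torsion cocycle plus a boundary, and m^T carries the cocycle
    into the boundaries. *)
Lemma koszul_bound (K : complex R) j N iota T n : @koszul_like K j N iota ->
  (j < n)%N ->
  (forall l, (l <= n)%N -> forall v : K l, gamma v -> cdiff K l v = 0 ->
     mkill m T (@bdry (@gamma) K l) v) ->
  forall u, tors m N u -> mkill m T N u.
Proof.
move=> [zeroK pureK lowK cocK surjK kerK highK] jn kK u tu.
have iZ a v : iota (a *: v) = a *: iota v by rewrite linearZ.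
have NB v : N v <-> @bdry all_elts K j.+1 (iota v).
  by rewrite -kerK; split=> [[w e]|[w _ e]]; exists w.
have [|z [_ [gz [w _ ->] uE]]] := torsion_boundary_split (i := j.+1) zeroK pureK lowK (v := iota u).
  have [S kS] := tu; exists S; rewrite -(mkill_preim m _ S u iZ).
  by apply: mkill_mono kS => v /NB.
apply: (mkill_mono (N := fun v => @bdry all_elts K j.+1 (iota v))) => [v /NB//|].
rewrite (mkill_preim m (@bdry all_elts K j.+1) T u iZ) uE.
have sB := submod_all_bdry K j.+1.
apply: submodD; first exact: submod_mkill.
  have dz : cdiff K j.+1 z = 0.
    by have := cocK u; rewrite uE linearD cdiff_dpred addr0.
  by apply: mkill_mono (kK j.+1 jn z gz dz) => _ [y _ ->]; exists y.
by apply: (mkill_le sB (leq0n T)); exists w.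
Qed.

End Splitting.

End Boundaries.

(** * The injective resolution and local cohomology *)

Section Resolution.
Variables (R : comNzRingType) (mp : {pred R}).
Hypothesis noeR : noetherian R.
Let m (a : R) : Prop := a \in mp.
Hypothesis im : ideal m.

Lemma torsionE (V : lmodType R) (v : V) : v \in torsion mp (V := V) <-> gamma m v.
Proof.
have kP t := mkill_prod (m := m) t (fun u : V => u = 0) v (ideal0 im).
split=> [/asboolP[t tv]|[t /kP tv]]; first by exists t; apply/kP.
by apply/asboolP; exists t.
Qed.

Variables (M : lmodType R) (I : injective_resolution M).

(** Shifted by one, with the zero module in degree 0 as the cones require; H^i_m(M) therefore sits
    in degree i + 1. *)
Definition res_ob (l : nat) : lmodType R := if l is l'.+1 then I l' else 'rV[R]_0.

Definition res_cdiff l : {linear res_ob l -> res_ob l.+1} :=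
  match l return {linear res_ob l -> res_ob l.+1} with
  | 0 => \0 : {linear 'rV[R]_0 -> I 0}
  | l'.+1 => res_diff I l'
  end.

Lemma res_cdiff2 l v : res_cdiff l.+1 (res_cdiff l v) = 0.
Proof.
case: l v => [|l] v /=; first by rewrite linear0.
by apply/res_exact; exists v.
Qed.

Definition res_complex : complex R := Complex res_cdiff2.

Lemma koszul_res :
  @koszul_like R m M res_complex 0 (fun v => v = 0) (res_aug I : {linear M -> res_complex 1}).
Proof.
have zeroK (v : 'rV[R]_0) : v = 0 by apply/rowP => -[].
split.
- exact: zeroK.
- by case=> [|l]; [apply: pure0_trivial|apply/pure0_injective/res_injective].
- by case=> // _ v _; exists 0; rewrite (zeroK v); exists 0; rewrite ?linear0.
- by move=> u; apply/res_exact0; exists u.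
- by move=> v /res_exact0[u <-]; exists u, 0; rewrite addr0.
- move=> u; split=> [[w e]|->]; last by exists 0; rewrite !linear0.
  by apply: (@res_aug_inj _ _ I); rewrite e linear0.
- by case=> // l _ v /res_exact[w <-]; exists w.
Qed.

Definition quot_class (V : lmodType R) (N : submodClosed V) (v : V) : quot_module N :=
  \pi_(Quotient.quot (submod_pred N)) v.

Lemma quot_classZ (V : lmodType R) (N : submodClosed V) a v :
  quot_class N (a *: v) = a *: quot_class N v.
Proof. by rewrite -[RHS]/(quot_scale a _) quot_scale_pi. Qed.

Lemma quot_class_eq0 (V : lmodType R) (N : submodClosed V) (v : V) :
  quot_class N v = 0 <-> v \in N.
Proof.
have e : (v \in N) = (quot_class N v == quot_class N 0).
  by have := Quotient.idealrBE (submod_pred N) v 0; rewrite subr0.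
have e0 : quot_class N 0 = 0 by have := quot_classZ N 0 0; rewrite !scale0r.
by rewrite e e0; split=> [->|/eqP].
Qed.

(** Finite length makes the chain of the submodules killed by m^j stationary. Every class comes from
    a torsion cocycle, so it lies in some member of the chain and hence in the stationary one. *)
Lemma finite_length_kill (i : nat) : finite_length (local_cohomology mp I i) ->
  exists T, forall z : I i, gamma m z -> res_diff I i z = 0 ->
    mkill m T (fun v => v \in boundary mp (I := I) (i := i)) z.
Proof.
set H := local_cohomology mp I i => -[b bP].
pose Z := submodule (cocycle mp (I := I) (i := i)).
pose cls (x : Z) : H := quot_class _ x.
have clsZ a x : cls (a *: x) = a *: cls x by apply: quot_classZ.
pose c j : {pred H} := fun h => `[< mkill m j (fun u => u = 0) h >].
have cE j h : h \in c j <-> mkill m j (fun u => u = 0) h by split=> /asboolP.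
have sc j : submod_closed (c j).
  have [s0 sP] := submod_mkill m j (submod_zero H).
  by split=> [|a u v /cE cu /cE cv]; apply/cE => //; apply: sP.
have [j jP] : exists j, {subset c j.+1 <= c j}.
  apply: contrapT => no; have := bP b.+1 c (fun i _ => sc i).
  rewrite ltnn => H'; suff: false by []; apply: H' => j _; split.
    by move=> h /cE kh; apply/cE; apply: (mkill_le (submod_zero H) (leqnSn j)).
  by move=> sub; apply: no; exists j.
have stable k h : mkill m (k + j) (fun u : H => u = 0) h -> mkill m j (fun u => u = 0) h.
  elim: k h => // k IH h; rewrite addSn => kh; apply/cE/jP/cE => x mx.
  exact/IH/kh.
exists j => z /(torsionE z) tz dz.
have zc : z \in cocycle mp (I := I) (i := i) by apply/andP; split=> //; apply/eqP.
pose x : Z := Sub z zc.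
have valZ a (u : Z) : val (a *: u) = a *: val u by rewrite linearZ.
have [S kS] : exists S, mkill m S (fun u => u = 0) (cls x).
  have [S kS] := iffLR (torsionE z) tz; exists S.
  rewrite -(mkill_preim m (fun u => u = 0) S x clsZ).
  have : mkill m S (fun y : Z => val y = 0) x.
    by rewrite (mkill_preim m (fun u => u = 0) S x valZ).
  apply: mkill_mono => y y0; have -> : y = 0 by apply: val_inj; rewrite y0 linear0.
  by apply/quot_class_eq0; rewrite rpred0.
have := stable S _ (mkill_le (submod_zero H) (leq_addr j S) kS).
rewrite -(mkill_preim m (fun u => u = 0) j x clsZ) => kj.
rewrite -[z]/(val x) -(mkill_preim m _ j x valZ).
by apply: mkill_mono kj => y /quot_class_eq0.
Qed.

Lemma gamma_res_kill n :
  (forall i, (i < n)%N -> finite_length (local_cohomology mp I i)) ->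
  exists T, forall l, (l <= n)%N -> forall v : res_complex l,
    gamma m v -> cdiff res_complex l v = 0 -> mkill m T (@bdry R (@gamma R m) res_complex l) v.
Proof.
have sB l := submod_bdry (@submod_gamma R m) res_complex l.
elim: n => [|n IH] fin.
  exists 0 => -[|l] // _ v _ _; have -> : v = 0 by apply/rowP => -[].
  exact: submod0 (sB 0).
have [i ni|S kS] := IH; first by apply: fin; apply: ltnW.
have [T kT] := finite_length_kill (fin n (ltnSn n)).
exists (maxn S T) => l; rewrite leq_eqVlt => /orP[/eqP-> v gv dv|ln v gv dv]; last first.
  by apply: (mkill_le (sB l) (leq_maxl S T)); apply: kS.
apply: (mkill_le (sB n.+1) (leq_maxr S T)).
apply: mkill_mono (kT v gv dv) => {v gv dv} v.
case: n v {IH fin kS kT} => [|n] v; first by move/eqP ->; exact: submod0 (sB 1%N).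
by move=> /asboolP[w /torsionE gw <-]; exists w.
Qed.

Lemma koszul_exists n T :
  (forall l, (l <= n)%N -> forall v : res_complex l, gamma m v ->
     cdiff res_complex l v = 0 -> mkill m T (@bdry R (@gamma R m) res_complex l) v) ->
  forall t, filter_regular m M t ->
  exists (K : complex R) (iota : {linear M -> K (size t).+1}),
    koszul_like m (ideal_smul t) iota /\
    forall l, (l <= n)%N -> forall v : K l, gamma m v -> cdiff K l v = 0 ->
      mkill m (2 ^ size t * T) (@bdry R (@gamma R m) K l) v.
Proof.
move=> kT; elim=> [_|x t IH [ft xreg]].
  exists res_complex, (res_aug I : {linear M -> res_complex 1}).
  by split; [apply: koszul_res|rewrite mul1n].
have [K [iota [kl kK]]] := IH ft.
exists (cone K x), (cone_iota x iota : {linear M -> cone K x (size t).+2}); split.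
  by apply: koszul_cone => //; apply: submod_ideal_smul.
rewrite expnS -mulnA mul2n -addnn; apply: cone_gamma_kill => //.
exact: kl_zero kl.
Qed.

(** Each element of [t] doubles the exponent, and [t] has fewer than [n] elements. *)
Lemma filter_regular_bound n :
  (forall i, (i < n)%N -> finite_length (local_cohomology mp I i)) ->
  exists T, forall t, filter_regular m M t -> (size t < n)%N ->
    forall v : M, tors m (ideal_smul t) v -> mkill m T (ideal_smul t) v.
Proof.
move=> /gamma_res_kill[T kT]; exists (2 ^ n * T)%N => t ft tn v tv.
have [K [iota [kl kK]]] := koszul_exists kT ft.
apply: (@mkill_le _ _ _ (2 ^ size t * T)); first exact: submod_ideal_smul.
  by rewrite leq_mul2r leq_exp2l // (ltnW tn) orbT.
exact: (koszul_bound noeR im kl tn kK).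
Qed.

End Resolution.

(** * Depth and dimension of localizations *)

Section LengthSup.

(** [supremum] selects a least upper bound if there is one, so one is exhibited: -oo, the maximum,
    or +oo. *)
Lemma length_sup_supremums (A : set nat) :
  supremums [set (k%:Z)%:E | k in A]%classic (length_sup A).
Proof.
have [->|/set0P[a Aa]] := eqVneq A set0.
  rewrite /length_sup image_set0 supremum0; split=> [x []//|x _].
  exact: leNye.
suff [s sP] : (supremums [set (k%:Z)%:E | k in A] !=set0)%classic.
  rewrite /length_sup /supremum; case: ifPn => [/eqP/image_set0_set0 A0|_].
    by move: Aa; rewrite A0.
  exact: xgetI sP.
have [[b bP]|unb] := pselect (exists b, forall k, A k -> (k <= b)%N).
  have ex : exists k, `[< A k >] by exists a; apply/asboolP.
  have ub k : `[< A k >] -> (k <= b)%N by move/asboolP/bP.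
  case: (ex_maxnP ex ub) => k /asboolP Ak kmax; exists (k%:Z)%:E; split.
    by move=> _ [l Al <-]; rewrite lee_fin lez_nat; apply: kmax; apply/asboolP.
  by move=> x; apply; exists k.
exists +oo%E; split=> [x _|x xub]; first exact: leey.
case: x xub => [z zub||zub] //; last by have := zub (a%:Z)%:E; apply; exists a.
exfalso; apply: unb; exists `|z|%N => k Ak.
have : ((k%:Z)%:E <= z%:E)%E by apply: zub; exists k.
by rewrite lee_fin; lia.
Qed.

Lemma length_sup_ge (A : set nat) k : A k -> ((k%:Z)%:E <= length_sup A)%E.
Proof. by move=> Ak; apply: (length_sup_supremums A).1; exists k. Qed.

Lemma length_sup_le (A B : set nat) :
  (forall k, A k -> exists2 l, B l & (k <= l)%N) -> (length_sup A <= length_sup B)%E.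
Proof.
move=> AB; apply: (length_sup_supremums A).2 => _ [k /AB[l Bl kl] <-].
by apply: le_trans (length_sup_ge Bl); rewrite lee_fin lez_nat.
Qed.

Lemma length_sup_bound (A : set nat) n k : length_sup A = (n%:Z)%:E -> A k -> (k <= n)%N.
Proof. by move=> An /length_sup_ge; rewrite An lee_fin lez_nat. Qed.

Lemma length_sup_nonempty (A : set nat) n : length_sup A = (n%:Z)%:E -> exists k, A k.
Proof.
move=> An; have [A0|/set0P//] := eqVneq A set0.
by move: An; rewrite A0 /length_sup image_set0 supremum0.
Qed.

End LengthSup.

Section PrimeIdealr.
Variable R : comNzRingType.

Lemma prime_idealr_of (P : R -> Prop) : prime_id P ->
  exists p : prime_idealr R, forall a, a \in p <-> P a.
Proof.
move=> [iP P1 Pp]; pose S : {pred R} := fun a => `[< P a >].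
have cS : idealr_closed S.
  split; [by apply/asboolP; apply: ideal0|by apply/asboolP|].
  by move=> a u v /asboolP Pu /asboolP Pv; apply/asboolP; apply: idealD => //; apply: idealM.
have pS : prime_idealr_closed S.
  by move=> a b /asboolP/Pp[] Pa; apply/orP; [left|right]; apply/asboolP.
pose S1 := isIdealr.Build R S cS; pose S2 := isPrimeIdealrClosed.Build R S pS.
pose p : prime_idealr R := HB.pack S S1 S2.
by exists p => a; split=> /asboolP.
Qed.

Lemma prime_id_idealr (p : prime_idealr R) : prime_id (fun a => a \in p).
Proof.
split; last by move=> a b; rewrite prime_idealrM => /orP.
  split=> [|a u v pu pv]; first exact: idealr0.
  by rewrite rpredD // idealMr.
by rewrite idealr1.
Qed.

Lemma prime_chain_of k (P : R -> Prop) : chain k P ->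
  exists c : nat -> prime_idealr R, (forall a, a \in c 0 <-> P a) /\
    forall i, (i < k)%N -> strict_subset (c i) (c i.+1).
Proof.
elim: k P => [|k IH] P [pP]; have [p pE] := prime_idealr_of pP.
  by exists (fun=> p).
move=> [Q [PQ [a [Qa nPa]] /IH[c [c0 cs]]]].
exists (fun i => if i is j.+1 then c j else p); split=> // -[_|i ik]; last exact: cs.
split=> [b /pE/PQ/c0//|sub]; apply/nPa/pE/sub.
exact/c0.
Qed.

Lemma prime_chain_cat I (c d : nat -> prime_idealr R) k l :
  {subset I <= c 0} -> (forall i, (i < k)%N -> strict_subset (c i) (c i.+1)) ->
  {subset c k <= d 0} -> (forall i, (i < l)%N -> strict_subset (d i) (d i.+1)) ->
  prime_chain I (k + l).
Proof.
(* [d 0] takes the place of [c k], so a non-strict inclusion suffices at the junction. *)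
move=> Ic cs cd ds; exists (fun i => if (i < k)%N then c i else d (i - k)%N); split.
  by case: ifP => // k0 a /Ic; move: cd; rewrite sub0n (_ : k = 0) //; [apply|lia].
move=> i ikl; case: ltnP => ik; last first.
  by rewrite ltnNge (leq_trans ik) //= subSn //; apply: ds; lia.
have [sub nsub] := cs i ik; case: ltnP => // ki.
have e : i.+1 = k by lia.
rewrite e subnn; move: sub nsub; rewrite e => sub nsub.
by split=> [a /sub/cd//|sub']; apply: nsub => a /cd/sub'.
Qed.

End PrimeIdealr.

(** * Noetherian local rings *)

Section LocalRing.
Variables (R : comNzRingType) (mp : {pred R}).
Hypotheses (noeR : noetherian R) (locR : local_ring mp).
Let m (a : R) : Prop := a \in mp.

(** Noetherian induction in place of Zorn's lemma: a proper ideal that is not maximal lies in a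
    strictly larger proper one. *)
Lemma local_ideal_sub (I : R -> Prop) : ideal I -> ~ I 1 -> forall a, I a -> m a.
Proof.
move: I; apply: (noeth_wf (noeth_ring noeR)) => I sI IH I1 a Ia.
have idS (J : {pred R}) : idealr_closed J <-> ideal (fun b => b \in J) /\ 1 \notin J.
  split=> [[J0 J1 JP]|[[J0 JP] J1]]; first by split=> //; split=> // b u v; apply: JP.
  by split=> // b u v; apply: JP.
have cI : idealr_closed (fun b => `[< I b >]).
  apply/idS; split; last exact/asboolP.
  split=> [|b u v /asboolP Iu /asboolP Iv]; first by apply/asboolP; apply: (submod0 sI).
  by apply/asboolP; apply: sI.2.
have [mI|nmI] := pselect (maximal_ideal (fun b => `[< I b >])).
  by rewrite /m -(locR.2 _ mI); apply/asboolP.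
have [J [/idS[iJ J1] IJ [b [Jb nIb]]]] : exists J : {pred R}, [/\ idealr_closed J,
    forall b, I b -> b \in J & exists b, b \in J /\ ~ I b].
  apply: contrapT => no; apply: nmI; split=> // J cJ IJ b Jb; apply/asboolP.
  apply: contrapT => nIb; apply: no; exists J; split=> //; last by exists b.
  by move=> d Id; apply: IJ; apply/asboolP.
have H := IH (fun c => c \in J) iJ IJ; apply: H; [by exists b|exact/negP|exact: IJ].
Qed.

Lemma local_ideal : ideal m.
Proof. by have [[[m0 _ mP] _] _] := locR; split=> // a u v; apply: mP. Qed.

Lemma local_prime : prime_id m.
Proof.
have [[[m0 m1 mP] _] _] := locR; have im := local_ideal.
split=> //; first exact/negP.
move=> a b mab; apply: contrapT => /not_orP[na nb].
pose I c := exists x r, m x /\ c = x + r * a.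
have iI : ideal I.
  split; first by exists 0, 0; rewrite mul0r addr0.
  move=> c _ _ [x [r [mx ->]]] [y [s [my ->]]]; exists (c * x + y), (c * r + s).
  split; first by apply: (idealD im) => //; apply: (idealM im).
  by rewrite -[_ *: _]/(c * (x + r * a)); ring.
have [[x [r [mx e]]]|nI1] := pselect (I 1); last first.
  apply: na; apply: (local_ideal_sub iI nI1).
  by exists 0, 1; rewrite add0r mul1r.
apply: nb; rewrite -[b]mul1r e mulrDl.
by apply: (idealD im); [rewrite mulrC|rewrite -mulrA]; apply: (idealM im).
Qed.

Lemma local_unit a : ~ m a -> exists b, b * a = 1.
Proof.
move=> na; apply: contrapT => no; apply: na.
apply: (@local_ideal_sub (fun c => exists b, c = b * a)).
- split; first by exists 0; rewrite mul0r.
  by move=> c _ _ [x ->] [y ->]; exists (c * x + y); rewrite mulrDl -mulrA.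
- by move=> [b e]; apply: no; exists b.
- by exists 1; rewrite mul1r.
Qed.

End LocalRing.

Section RegularSequences.
Variables (R : comNzRingType) (V : lmodType R).

Lemma ideal_mulE (s : seq R) (v : V) : v \in ideal_mul s (V := V) <-> ideal_smul (rev s) v.
Proof.
elim/last_ind: s v => [|s x IH] v.
  split=> [/asboolP[c ->]|->]; first by rewrite big_ord0.
  by apply/asboolP; exists (fun=> 0); rewrite big_ord0.
rewrite rev_rcons /=; split=> [/asboolP[c]|[n [w [/IH/asboolP[c ->] ->]]]].
  rewrite size_rcons big_ord_recr /= nth_rcons ltnn eqxx => ->.
  exists (\sum_(i < size s) s`_i *: c i), (c (size s)); split.
    by apply/IH/asboolP; exists c.
  by congr (_ + _); apply: eq_bigr => i _; rewrite nth_rcons ltn_ord.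
apply/asboolP; exists (fun i => if i == size s then w else c i).
rewrite size_rcons big_ord_recr /= nth_rcons ltnn !eqxx; congr (_ + _).
by apply: eq_bigr => i _; rewrite nth_rcons ltn_ord ltn_eqF.
Qed.

Fixpoint regular (t : seq R) : Prop :=
  if t is x :: t' then regular t' /\
    forall v : V, ideal_smul t' (x *: v) -> ideal_smul t' v
  else True.

Lemma regular_seqE (s : seq R) :
  regular_seq V s <-> regular (rev s) /\ exists v : V, ~ ideal_smul (rev s) v.
Proof.
have ex : (exists v : V, v \notin ideal_mul s (V := V)) <->
    exists v : V, ~ ideal_smul (rev s) v.
  by split=> -[v sv]; exists v; [move/ideal_mulE; apply/negP|apply/negP; move/ideal_mulE].
have reg : (forall i, (i < size s)%N -> forall v : V,
    s`_i *: v \in ideal_mul (take i s) (V := V) -> v \in ideal_mul (take i s) (V := V)) <->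
    regular (rev s).
  elim/last_ind: s {ex} => [|s x IH]; first by split.
  rewrite rev_rcons size_rcons /=; split=> [H|[/IH reg xreg] i]; last first.
    rewrite ltnS leq_eqVlt => /orP[/eqP->|ik] v.
      rewrite nth_rcons ltnn eqxx -cats1 take_size_cat // => /ideal_mulE/xreg.
      by move/ideal_mulE.
    by rewrite nth_rcons ik -cats1 takel_cat ?(ltnW ik) //; apply: reg.
  split.
    apply/IH => i ik v; have := H i (ltnW ik) v.
    by rewrite nth_rcons ik -cats1 takel_cat ?(ltnW ik).
  move=> v; have := H (size s) (ltnSn _) v.
  by rewrite nth_rcons ltnn eqxx -cats1 take_size_cat // => H' /ideal_mulE/H'/ideal_mulE.
by split=> -[rs es]; (split; [exact/reg|exact/ex]).
Qed.

End RegularSequences.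

(** * Transfer between R and its localization at p *)

Section Transfer.
Variables (R : comNzRingType) (p : prime_idealr R).
Let P (a : R) : Prop := a \in p.
Let pP : prime_id P := prime_id_idealr p.

Definition denom_of (h : R) (hP : ~ P h) : denom p := Sub h (introN idP hP).

Lemma denomP (s : denom p) : ~ P (dval s).
Proof. exact/negP/(valP s). Qed.

Definition to_loc (a : R) : loc_ring p := fracp (a : R^o) (denom1 p).

Lemma to_locD a b : to_loc (a + b) = to_loc a + to_loc b.
Proof.
rewrite -[RHS]/(loc_add _ _) loc_addE dval1 !scale1r.
by apply/fracpP; exists (denom1 p); rewrite !dvalM !dval1 !mulr1.
Qed.

Lemma to_locM a b : to_loc (a * b) = to_loc a * to_loc b.
Proof.
rewrite -[RHS]/(loc_scale (to_loc a) (to_loc b)) loc_scaleE.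
by apply/fracpP; exists (denom1 p); rewrite !dvalM !dval1 !mulr1.
Qed.

Lemma to_loc0 : to_loc 0 = 0. Proof. by []. Qed.

Lemma to_loc1 : to_loc 1 = 1. Proof. by []. Qed.

Lemma fracp_to_loc (a : R) s : to_loc a = to_loc (dval s) * fracp (a : R^o) s.
Proof.
rewrite -[RHS]/(loc_scale (to_loc (dval s)) _) loc_scaleE.
apply/fracpP; exists (denom1 p); rewrite !dvalM !dval1 !scale1r mul1r.
by [].
Qed.

Lemma to_loc_unit (s : denom p) : exists y, y * to_loc (dval s) = 1.
Proof.
exists (fracp (1 : R^o) s); rewrite mulrC.
rewrite -[LHS]/(loc_scale (to_loc (dval s)) _) loc_scaleE.
apply/fracpP; exists (denom1 p); rewrite !dvalM !dval1 !scale1r mul1r.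
by rewrite /GRing.scale /= !mulr1.
Qed.

Section Module.
Variable V : lmodType R.

Lemma fracp_eq0 (v : V) (s : denom p) :
  fracp v s = 0 <-> exists u : denom p, dval u *: v = 0.
Proof.
rewrite -[0]/(fracp (0 : V) (denom1 p)) fracpP dval1 scale1r.
by split=> -[u e]; exists u; rewrite e !scaler0.
Qed.

Lemma fracpD (v w : V) (s : denom p) : fracp (v + w) s = fracp v s + fracp w s.
Proof.
rewrite -[RHS]/(loc_add _ _) loc_addE; apply/fracpP; exists (denom1 p).
by rewrite !dvalM dval1 !scale1r -scalerDr scalerA.
Qed.

Lemma to_loc_scale (x : R) (w : V) s : to_loc x *: fracp w s = fracp (x *: w) s.
Proof. by rewrite -[LHS]/(loc_scale _ _) loc_scaleE denom1M. Qed.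

(** The bridge from V_p back to [V]: it turns regularity of the images of [t] into
    [locally_regular]. *)
Lemma ideal_smul_loc (t : seq R) (v : V) (d : denom p) :
  ideal_smul (map to_loc t) (fracp v d) <-> sat P (ideal_smul t) v.
Proof.
elim: t v d => [|x t IH] v d /=.
  rewrite fracp_eq0; split=> [[u e]|[h [Ph e]]].
    by exists (dval u); split=> //; apply: denomP.
  by exists (denom_of Ph).
have [_ P1 Pp] := pP; have sN := submod_ideal_smul V t.
split=> [[N [W [tN]]]|[h [Ph [n [w [tn e]]]]]]; last first.
  exists (fracp n (denomM (denom_of Ph) d)), (fracp w (denomM (denom_of Ph) d)); split.
    by apply/IH; exists 1; rewrite scale1r.
  by rewrite to_loc_scale -fracpD -e; exact: esym (fracp_scale (denom_of Ph) v d).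
have [n [a NE]] := fracp_surj N; have [w [b WE]] := fracp_surj W.
move: tN; rewrite NE WE => /IH[h [Ph hn]].
rewrite to_loc_scale -[X in _ = X]/(loc_add _ _) loc_addE => /fracpP[u].
rewrite dvalM => e.
exists (h * (dval u * (dval a * dval b))); split.
  by move=> /Pp[//|/Pp[|/Pp[]]]; apply: denomP.
exists ((dval u * dval d * dval b) *: (h *: n)),
  ((h * dval u * dval d * dval a) *: w); split; first exact: submodZ.
rewrite -scalerA -[(dval u * _) *: v]scalerA e !scalerDr !scalerA.
by congr (_ *: _ + _ *: _); ring.
Qed.

Fixpoint locally_regular (t : seq R) : Prop :=
  if t is x :: t' then locally_regular t' /\
    forall v : V, ideal_smul t' (x *: v) -> sat P (ideal_smul t') v
  else True.

Lemma regular_loc (t : seq R) :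
  regular (localization p V) (map to_loc t) <-> locally_regular t.
Proof.
elim: t => //= x t IH; split=> -[/IH reg xreg]; split=> //.
  move=> v xv; apply: (iffLR (ideal_smul_loc t v (denom1 p))); apply: xreg.
  rewrite to_loc_scale; apply/ideal_smul_loc; exists 1; rewrite scale1r; split=> //.
  by have [] := pP.
move=> y; have [v [d ->]] := fracp_surj y.
rewrite to_loc_scale => /ideal_smul_loc[h [Ph hx]]; apply/ideal_smul_loc.
apply: (sat_idem pP Ph); apply: xreg.
by rewrite scalerA mulrC -scalerA.
Qed.

(** If [t] generated all of V_p, Nakayama would give an element outside [p] that kills [V], against
    the support condition. *)
Lemma loc_regular_seq (t : seq R) : fin_gen (@predT V) -> in_support V p ->
  (forall x, x \in t -> P x) -> locally_regular t ->
  regular_seq (localization p V) (map to_loc (rev t)).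
Proof.
move=> [g gP] [y0 ny0] tP reg; apply/regular_seqE; rewrite -map_rev revK.
split; first exact/regular_loc.
apply: contrapT => no.
have tv (v : V) : sat P (ideal_smul t) v.
  refine (iffLR (ideal_smul_loc t v (denom1 p)) _); apply: contrapT => nv.
  by apply: no; exists (fracp v (denom1 p)).
have gspan v : span g v by apply/spanE/(iffLR (gP v)).
have t_pspan v : ideal_smul t v -> pspan P g v.
  have sp := submod_pspan pP g.
  elim: t tP v {reg no tv} => [|x t IH] tP v /=; first by move=> ->; apply: submod0.
  move=> [n [w [tn ->]]]; apply: submodD => //.
    by apply: IH => // z zt; apply: tP; rewrite inE zt orbT.
  by apply: pspanZ => //; apply: tP; rewrite inE eqxx.
have [x xg|u [Pu uP]] := nakayama (N := fun v => v = 0) (s := g) pP (submod_zero V).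
  have [h [Ph hx]] := tv x; exists h, 0, (h *: x); rewrite add0r; split=> //.
  exact: t_pspan.
move/eqP: ny0; apply; have [v [s ->]] := fracp_surj y0.
apply/fracp_eq0; exists (denom_of Pu).
exact: (span_min (submod_scale u (submod_zero V)) uP (gspan v)).
Qed.

End Module.

Lemma to_loc_ideal x : P x -> to_loc x \in @loc_ideal R p.
Proof. by move=> Px; apply/asboolP; exists x, (denom1 p). Qed.

Lemma annihilator_loc (V : lmodType R) a :
  a \in annihilator V -> to_loc a \in annihilator (localization p V).
Proof.
move=> /asboolP aV; apply/asboolP => y; have [v [s ->]] := fracp_surj y.
by rewrite to_loc_scale aV; apply/fracp_eq0; exists (denom1 p); rewrite scaler0.
Qed.

Lemma prime_contract (Q : prime_idealr (loc_ring p)) :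
  prime_id (fun a => to_loc a \in Q).
Proof.
split.
- split=> [|a u v Qu Qv]; first by rewrite to_loc0 idealr0.
  by rewrite to_locD -[a *: u]/(a * u) to_locM rpredD // idealMr.
- by rewrite to_loc1 idealr1.
- by move=> a b; rewrite to_locM prime_idealrM => /orP.
Qed.

Lemma loc_prime_sub (Q : prime_idealr (loc_ring p)) a : to_loc a \in Q -> P a.
Proof.
move=> Qa; apply: contrapT => Pa; have [y e] := to_loc_unit (denom_of Pa).
by have := idealMr y Qa; rewrite [_ * _]e idealr1.
Qed.

Lemma mem_contract (Q : prime_idealr (loc_ring p)) (a : R) s :
  fracp (a : R^o) s \in Q <-> to_loc a \in Q.
Proof.
rewrite (fracp_to_loc a s); split=> [Qa|]; first exact: idealMr.
by rewrite prime_idealrM => /orP[/loc_prime_sub/denomP|].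
Qed.

Lemma prime_chain_contract (J : {pred loc_ring p}) k : prime_chain J k ->
  exists c : nat -> prime_idealr R, [/\ forall a, to_loc a \in J -> a \in c 0,
    forall i, (i < k)%N -> strict_subset (c i) (c i.+1) & forall i, {subset c i <= p}].
Proof.
move=> [c [Jc cs]].
have [q qP] := choice (fun i => prime_idealr_of (prime_contract (c i))).
exists q; split.
- by move=> a /Jc c0; apply/qP.
- move=> i /cs[sub nsub]; split=> [a /qP/sub ca|sub']; first exact/qP.
  apply: nsub => y; have [a [s ->]] := fracp_surj y.
  move=> /(iffLR (mem_contract _ _ _))/(iffRL (qP _ _))/sub'/(iffLR (qP _ _)) ca.
  exact/(iffRL (mem_contract _ _ _)).
- by move=> i a /qP/loc_prime_sub.
Qed.

Section Extension.
Variable q : prime_idealr R.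
Hypothesis qp : {subset q <= p}.

Definition extension (y : loc_ring p) : Prop :=
  exists (a : R) s, a \in q /\ y = fracp (a : R^o) s.

Lemma extensionE (a : R) s : extension (fracp (a : R^o) s) <-> a \in q.
Proof.
split=> [[b [t [qb /fracpP[u e]]]]|qa]; last by exists a, s.
have nq (d : denom p) : dval d \notin q.
  by apply/negP => /qp; apply: denomP.
have : dval u * (dval t * a) \in q.
  by rewrite [_ * _]e; do 2!apply: idealMr.
by rewrite !prime_idealrM (negPf (nq u)) (negPf (nq t)).
Qed.

Lemma prime_extension : prime_id extension.
Proof.
split.
- split=> [|x y z]; first by apply/extensionE; apply: idealr0.
  have [a [s ->]] := fracp_surj x; have [b [t ->]] := fracp_surj y.
  have [c [u ->]] := fracp_surj z => /extensionE qb /extensionE qc.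
  rewrite -[_ *: _]/(loc_scale _ _) loc_scaleE.
  rewrite -[_ + _]/(loc_add _ _) loc_addE.
  apply/extensionE; rewrite -[_ + _]/(dval u * (a * b) + dval (denomM s t) * c).
  by rewrite rpredD // idealMr // idealMr.
- rewrite -[1]/(fracp (1 : R^o) (denom1 p)) => /extensionE.
  by rewrite idealr1.
- move=> x y; have [a [s ->]] := fracp_surj x; have [b [t ->]] := fracp_surj y.
  rewrite -[_ * _]/(loc_scale _ _) loc_scaleE => /extensionE.
  rewrite -[_ *: _]/(a * b) prime_idealrM => /orP[] ?; [left|right]; exact/extensionE.
Qed.

End Extension.

Lemma prime_chain_extend (I : {pred R}) (J : {pred loc_ring p}) k :
  (forall q : prime_idealr R, {subset q <= p}) ->
  (forall (a : R) s, fracp (a : R^o) s \in J -> a \in I) ->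
  prime_chain I k -> prime_chain J k.
Proof.
move=> qp JI [c [Ic cs]].
have [q qP] := choice (fun i => prime_idealr_of (prime_extension (qp (c i)))).
have qE i (a : R) s : fracp (a : R^o) s \in q i <-> a \in c i.
  by rewrite qP; apply: extensionE.
exists q; split.
  move=> y; have [a [s ->]] := fracp_surj y.
  by move=> /JI/Ic c0; apply/qE.
move=> i /cs[sub nsub]; split=> [y|sub'].
  by have [a [s ->]] := fracp_surj y => /qE/sub ca; apply/qE.
apply: nsub => a ca; apply/(qE i a (denom1 p))/sub'.
exact/qE.
Qed.

End Transfer.

(** * The two directions of the theorem *)

Section CohenMacaulay.
Variables (R : comNzRingType) (mp : {pred R}) (M : lmodType R) (n : nat).
Hypotheses (noeR : noetherian R) (locR : local_ring mp) (fgM : fin_gen (@predT M)).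
Let m (a : R) : Prop := a \in mp.
Let noeM : noeth_mod M := noeth_fin_gen noeR fgM.
Let pm : prime_id m := local_prime noeR locR.
Let local := local_ideal_sub noeR locR.

Lemma depth_ge_regular (p : prime_idealr R) (t : seq R) : in_support M p ->
  (forall x, x \in t -> x \in p) -> locally_regular p M t ->
  [set l | exists s : seq (loc_ring p), [/\ size s = l, {subset s <= @loc_ideal R p}
     & regular_seq (localization p M) s]]%classic (size t).
Proof.
move=> supp tp reg; exists (map (@to_loc R p) (rev t)); split.
- by rewrite size_map size_rev.
- by move=> y /mapP[x xt ->]; apply: to_loc_ideal; apply: tp; rewrite -mem_rev.
- exact: loc_regular_seq.
Qed.

Lemma filter_regular_local (p : prime_idealr R) (t : seq R) :
  ~ (forall x, m x -> x \in p) -> filter_regular m M t -> locally_regular p M t.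
Proof.
move=> mp'; elim: t => //= x t IH [/IH reg xreg]; split=> // v /xreg.
by move=> tv; apply: (tors_sat (prime_id_idealr p) _ tv) => mp''; apply: mp'.
Qed.

Lemma krull_dim_le_depth (p : prime_idealr R) : krull_dim M = (n%:Z)%:E ->
  generalized_CM mp M -> in_support M p -> ~ (forall x, m x -> x \in p) ->
  (krull_dim (localization p M) <= depth (@loc_ideal R p) (localization p M))%E.
Proof.
move=> dimM [res cm] supp nmp; have pp := prime_id_idealr p.
have [|T bound] := @filter_regular_bound R mp noeR (local_ideal locR) M res n.
  by move=> i ni; apply: cm; rewrite dimM lte_fin ltz_nat.
have nilp x : x \in [::] -> x \in p by [].
have [t [d [ft tp /prime_chain_of[e [e0 es]] td]]] :=
  filter_regular_extend noeR pm local noeM bound pp nmp (t := [::]) I nilp (erefl n).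
apply: length_sup_le => k /prime_chain_contract[c [cI cs cp]].
exists (size t); first exact/depth_ge_regular/filter_regular_local.
(* The chain of length [k] below [p] continues with the one of length [d] above it, while n is at
   most |t| + d. *)
suff : (k + d <= n)%N by lia.
apply: (length_sup_bound dimM); apply: (@prime_chain_cat _ _ c e) => //.
  by move=> a aM; apply/cI/annihilator_loc.
by move=> a /cp; apply: (iffRL (e0 a)).
Qed.

Lemma generalized_CM_serre : krull_dim M = (n%:Z)%:E -> generalized_CM mp M ->
  serre (depth mp M) M.
Proof.
move=> dimM cm p supp; have [mp'|nmp] := pselect (forall x, m x -> x \in p); last first.
  by rewrite ge_min (krull_dim_le_depth dimM cm supp nmp).
rewrite ge_min; apply/orP; right; apply: length_sup_le => _ [s [<- sm /regular_seqE[reg _]]].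
exists (size s) => //; rewrite -(size_rev s); apply: depth_ge_regular => //.
  by move=> x; rewrite mem_rev => /sm/mp'.
elim: (rev s) reg => //= x t IH [/IH reg xreg]; split=> // v /xreg.
by move=> tv; apply: (sat_sub (prime_id_idealr p)).
Qed.

(** Elements outside the maximal ideal are units, so localizing there loses neither dimension nor
    depth. *)
Lemma serre_depth r : krull_dim M = (n%:Z)%:E -> (r <= n)%N ->
  serre (r%:Z)%:E M -> ((r%:Z)%:E <= depth mp M)%E.
Proof.
move=> dimM rn serreM; have [p pE] := prime_idealr_of pm.
have unit (u : denom p) : exists b, b * dval u = 1.
  by apply: (local_unit noeR locR) => /pE; apply: denomP.
have unitK (u : denom p) (v : M) : dval u *: v = 0 -> v = 0.
  by move=> uv; have [b e] := unit u; rewrite -[v]scale1r -e -scalerA uv scaler0.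
(* The dimension [n] is not -oo, so some prime contains the annihilator and M is nonzero. *)
have supp : in_support M p.
  have [k [c [Mc _]]] := length_sup_nonempty dimM.
  apply: contrapT => no.
  have : 1 \in annihilator M; last by move/Mc; rewrite idealr1.
  apply/asboolP => v; rewrite scale1r.
  have /fracp_eq0[u /unitK//] : fracp v (denom1 p) = 0.
  by apply: contrapT => /eqP ny; apply: no; exists (fracp v (denom1 p)).
have dimle : (krull_dim M <= krull_dim (localization p M))%E.
  apply: length_sup_le => k ck; exists k => //.
  apply: (prime_chain_extend (I := annihilator M)) ck.
    move=> q a qa; apply/pE; have [iq q1 _] := prime_id_idealr q.
    exact: (local iq q1 qa).
  move=> a s /asboolP aM; apply/asboolP => v.
  have := aM (fracp v (denom1 p)); rewrite -[LHS]/(loc_scale _ _) loc_scaleE.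
  by move=> /fracp_eq0[u /unitK].
apply: (le_trans (y := Order.min (krull_dim (localization p M)) (r%:Z)%:E)).
  by rewrite le_min lexx andbT; apply: le_trans dimle; rewrite dimM lee_fin lez_nat.
apply: le_trans (serreM p supp) _.
apply: length_sup_le => _ [s [<- sp /regular_seqE[reg [y ny]]]].
(* A fraction a / d is the image of b a, where b is the inverse of d in [R]. *)
have [t st tm] : exists2 t : seq R, s = map (@to_loc R p) t & {subset t <= mp}.
  elim: s sp {reg ny} => [|x s IH] sp; first by exists [::].
  have [|t -> tm] := IH; first by move=> z zs; apply: sp; rewrite inE zs orbT.
  have /asboolP[a [d [pa xE]]] := sp x (mem_head _ _); have [b bd] := unit d.
  exists ((b * a) :: t) => /=.
    congr (_ :: _); rewrite xE.
    transitivity (to_loc p b * (to_loc p (dval d) * fracp a d)).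
      by rewrite mulrA -to_locM bd to_loc1 mul1r.
    by rewrite -fracp_to_loc -to_locM.
  move=> z; rewrite inE => /orP[/eqP->|/tm//].
  by apply/pE; apply: idealMr.
have unitS (N : M -> Prop) v : submod N -> sat (fun a => a \in p) N v -> N v.
  move=> sN [h [ph hv]].
  have [b bh] := local_unit noeR locR (a := h) (fun mh => ph (iffRL (pE h) mh)).
  by rewrite -[v]scale1r -bh -scalerA; apply: submodZ.
exists (size t); last by rewrite st size_map.
exists t; split=> //; apply/regular_seqE; move: reg ny; rewrite st -map_rev => reg ny.
split; last first.
  have [v [d yE]] := fracp_surj y; exists v => tv; apply: ny; rewrite yE.
  by apply/ideal_smul_loc; apply: (sat_sub (prime_id_idealr p)).
have {}reg := iffLR (regular_loc _ _ _) reg.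
elim: (rev t) reg => //= x u IH [/IH rt xreg]; split=> // v /xreg.
by apply: unitS; apply: submod_ideal_smul.
Qed.

End CohenMacaulay.

Theorem theorem1p2 (R : comNzRingType) (m : {pred R}) (M : lmodType R)
    (n : nat) :
  noetherian R -> local_ring m -> fin_gen (@predT M) ->
  krull_dim M = (n%:Z)%:E ->
  generalized_CM m M ->
  serre (depth m M) M /\
  (equidimensional M -> image_of_gorenstein R ->
   forall r : nat, (r <= n)%N -> serre (r%:Z)%:E M ->
     ((r%:Z)%:E <= depth m M)%E).
Proof.
move=> noeR locR fgM dimM cm; split; first exact: generalized_CM_serre dimM cm.
by move=> _ _ r rn; apply: serre_depth dimM rn.
Qed.
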